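(* For every positive integer $n$, \[ \Delta(n)=\begin{cases}7\cdot 3^{6s+4} & \text{if } n=3^{6s+5}+1 \text{ or } n=3^{6s+5}+2 \text{ for some } s\in \{0,1,2,\dots\},\\[2pt] 3^{\lceil \log_3 n\rceil} & \text{otherwise.}\end{cases} \]
   Context: For a positive integer $n$, $\Delta(n)$ denotes the smallest positive integer $m$ such that the integers $a^3+a$ $(1\le a\le n)$ are pairwise distinct modulo $m$. Here $\lceil x\rceil$ denotes the smallest integer no less than $x$. *)

(* Defs.v *)
From mathcomp Require Import all_boot.

Set Implicit Arguments.
Unset Strict Implicit.
Unset Printing Implicit Defensive.

Definition cubic (a : nat) : nat := a ^ 3 + a.

Definition distinct_mod (n m : nat) : bool :=
  pairwise (fun a b => cubic a != cubic b %[mod m]) (iota 1 n).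

Lemma cubic_mono (a b : nat) : a < b -> cubic a < cubic b.
Proof. by move=> ab; rewrite /cubic -addnS leq_add // leq_exp2r // ltnW. Qed.

Lemma Delta_exists (n : nat) : exists m, (0 < m) && distinct_mod n m.
Proof.
exists (cubic n).+1; rewrite /= /distinct_mod.
have cubicS c : c \in iota 1 n -> cubic c %% (cubic n).+1 = cubic c.
  rewrite mem_iota add1n ltnS => /andP[_ cn]; rewrite modn_small // ltnS.
  by move: cn; rewrite leq_eqVlt => /orP[/eqP->//|/cubic_mono/ltnW].
have := iota_ltn_sorted 1 n; rewrite (sorted_pairwise ltn_trans).
apply: (@sub_in_pairwise _ (mem (iota 1 n))); last exact/allP.
by move=> a b /cubicS ca /cubicS cb ab; rewrite ca cb neq_ltn cubic_mono.
Qed.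

Definition Delta (n : nat) : nat := ex_minn (Delta_exists n).

(* Main.v *)
(* Write f(x) = x^3 + x and Q(a,b) = a^2 + ab + b^2 + 1, so that
   f(b) - f(a) = (b - a) Q(a,b). As 3 never divides Q, f is injective modulo 3^k;
   it remains to find a collision on [1, n], n > 3^(k-1), for every other m < 3^k.

   If Q(a,b) = 0 mod P, the triple a, b, -a-b has sum 0 and a common value.
   Suppose P || m has such a triple of distinct residues, and m = P e. If 3 | e,
   represent the triple, divided by e/3, in [1, P]: the sum is P or 2P, hence prime
   to 3, so two of the representatives agree mod 3, and multiplying back by e/3
   gives a collision. If 3 does not divide e > 3, the about 3n/P > e - 2 elements of
   [1, n] in the three classes share their value mod P, while f misses at least two
   residues mod e, and the pigeonhole principle applies.

   The moduli P and 2P remain, for P = p^i. Here f has about 2P/3 values, which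
   settles 2P by pigeonhole. For P itself, f(a) = f(-b) with a, b in [1, n] forces
   f(b - a) = f(a); so, up to at most three exceptional b, injectivity on [1, n]
   propagates to [-n, n], which has more than 2P/3 elements. The counts are equal
   in one case only, which a power sum computation excludes. Finally, there is no
   triple of distinct residues mod 7, whence the exceptional moduli 7 * 3^j. *)

Require Import Defs.
From mathcomp Require Import all_boot all_algebra all_field zify ring.

Set Implicit Arguments.
Unset Strict Implicit.
Unset Printing Implicit Defensive.

(** * Collisions *)

Definition quad (a b : nat) : nat := a ^ 2 + a * b + b ^ 2 + 1.

Definition collides (n m : nat) : Prop :=
  exists a b, [/\ 0 < a, a < b, b <= n & m %| (b - a) * quad a b].

Lemma quadC a b : quad a b = quad b a.
Proof. rewrite /quad; ring. Qed.

Lemma cubic_eqmod m a b : a <= b ->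
  (cubic a == cubic b %[mod m]) = (m %| (b - a) * quad a b).
Proof.
move=> /subnKC <-; move: (b - a) => d; rewrite addKn.
have -> : cubic (a + d) = cubic a + d * quad a (a + d).
  rewrite /cubic /quad; ring.
by rewrite eq_sym eqn_mod_dvd ?leq_addr // addKn.
Qed.

Lemma collides_cubic n m a b : 0 < a -> 0 < b -> a <= n -> b <= n -> a != b ->
  cubic a = cubic b %[mod m] -> collides n m.
Proof.
move=> a0 b0 an bn; rewrite neq_ltn => /orP[ab|ba] /eqP E.
  by exists a, b; split=> //; rewrite -cubic_eqmod // ltnW.
by exists b, a; split=> //; rewrite -cubic_eqmod 1?ltnW // eq_sym.
Qed.

Lemma distinct_modPn n m : reflect (collides n m) (~~ distinct_mod n m).
Proof.
have nthE i : i < n -> nth 0 (iota 1 n) i = i.+1 by move=> ?; rewrite nth_iota.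
apply: (iffP idP) => [/(pairwiseP 0) H|[a [b [a0 ab bn dv]]]].
  case: (boolP [exists i : 'I_n, exists j : 'I_n,
     (i < j) && (cubic i.+1 == cubic j.+1 %[mod m])]).
    move=> /existsP[i /existsP[j /andP[ij E]]].
    exists i.+1, j.+1; split=> //.
    by rewrite -cubic_eqmod // ltnW // ltnS.
  move=> /existsPn Hn; case: H => i j; rewrite !inE size_iota => i_n j_n ij.
  rewrite !nthE //; have /existsPn/(_ (Ordinal j_n)) := Hn (Ordinal i_n).
  by rewrite /= ij.
case: a b a0 ab bn dv => [|a] [|b] // _ ab bn; rewrite -cubic_eqmod 1?ltnW // => E.
apply/negP => /(pairwiseP 0) /(_ a b); rewrite !inE size_iota.
have an : a < n by apply: leq_trans bn; exact: ltnW.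
by move=> /(_ an bn ab); rewrite !nthE // E.
Qed.

Lemma collidesW n n' m : n <= n' -> collides n m -> collides n' m.
Proof. by move=> le [a [b [? ? ? ?]]]; exists a, b; split=> //; apply: leq_trans le. Qed.

(** Modulo 3, Q(a,b) is (a - b)^2 + 1, and -1 is not a square modulo 3. *)
Lemma coprime3_quad a b : coprime 3 (quad a b).
Proof.
rewrite prime_coprime // /dvdn /quad.
rewrite [a](divn_eq a 3) [b](divn_eq b 3).
have : a %% 3 < 3 by rewrite ltn_mod.
have : b %% 3 < 3 by rewrite ltn_mod.
move: (a %/ 3) (b %/ 3) (a %% 3) (b %% 3) => x y [|[|[|r]]] [|[|[|s]]] // _ _; lia.
Qed.

Lemma collides_pow3 n k : n <= 3 ^ k -> ~ collides n (3 ^ k).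
Proof.
move=> nk [a [b [a0 ab bn]]].
rewrite Gauss_dvdl ?coprimeXl ?coprime3_quad // => /dvdn_leq.
by rewrite subn_gt0 => /(_ ab); lia.
Qed.

Lemma collides_lt n m : 0 < m -> m < n -> collides n m.
Proof. by move=> m0 mn; exists 1, m.+1; split=> //; rewrite subSS subn0 dvdn_mulr. Qed.

(** For m = 2h take the pair 1, h + 1: here Q = h^2 + 3h + 4 is even. *)
Lemma collides_even n m : 0 < m -> 2 %| m -> m < n.*2 -> collides n m.
Proof.
move=> m0 /dvdnP[h mE]; rewrite {}mE in m0 * => hn.
exists 1, h.+1; split=> //; try lia.
rewrite subSS subn0 dvdn_mul // /quad.
have : ~~ odd (h * h.+1) by rewrite oddM /= andbN.
rewrite dvdn2; lia.
Qed.

(** For m = 16h take the pair 1, 4h + 1: here Q = 4(4h^2 + 3h + 1). *)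
Lemma collides_16 n m : 0 < m -> 16 %| m -> m < 3 * n -> collides n m.
Proof.
move=> m0 /dvdnP[h mE]; rewrite {}mE in m0 * => hn.
exists 1, (4 * h).+1; split=> //; try lia.
rewrite subSS subn0 (_ : h * 16 = (4 * h) * 4); last by lia.
by rewrite dvdn_mul // /quad; apply/dvdnP; exists (4 * h ^ 2 + 3 * h + 1); ring.
Qed.

(* The congruence [Q(a,b) = 0 mod P] has its third root [-a-b]; the last two
   conditions say that this root is distinct from [b] and from [a]. *)
Definition split_mod (P : nat) : Prop :=
  exists a b, [/\ P %| quad a b, ~~ (a == b %[mod P]),
                  ~~ (P %| a + b.*2) & ~~ (P %| a.*2 + b)].

(** * Moduli having a value with three preimages *)

Lemma quad_eqmod m a a' b b' : a = a' %[mod m] -> b = b' %[mod m] ->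
  quad a b = quad a' b' %[mod m].
Proof.
move=> Ea Eb; rewrite /quad; apply/eqP; rewrite eqn_modDr; apply/eqP.
rewrite -[LHS]modnDm -[RHS]modnDm -(modnXm 2 m b) -(modnXm 2 m b') Eb; congr (((_ + _) %% _)).
by rewrite -[LHS]modnDm -[RHS]modnDm -(modnXm 2 m a) -(modnXm 2 m a') -modnMm Ea Eb modnMm.
Qed.

Lemma cubic_mod a m : cubic (a %% m) = cubic a %[mod m].
Proof. by rewrite /cubic -modnDm modnXm modn_mod modnDm. Qed.

Lemma cubic_eqmod_arg m a b : a = b %[mod m] -> cubic a = cubic b %[mod m].
Proof. by move=> E; rewrite -(cubic_mod a) -(cubic_mod b) E. Qed.

(** Q(b,c) - Q(a,b) = (c - a)(a + b + c). *)
Lemma quad_third_root m a b c : m %| a + b + c -> m %| quad a b -> m %| quad b c.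
Proof.
move=> s q; have E : quad b c + a * (a + b + c) = quad a b + c * (a + b + c).
  by rewrite /quad; ring.
by rewrite -(dvdn_addl _ (dvdn_mull a s)) E dvdn_add // dvdn_mull.
Qed.

Lemma quad_cubic m a b : m %| quad a b -> cubic a = cubic b %[mod m].
Proof.
move=> q; case: (leqP a b) => [ab|/ltnW ba]; apply/eqP.
  by rewrite cubic_eqmod // dvdn_mull.
by rewrite eq_sym cubic_eqmod // quadC dvdn_mull.
Qed.

(** Representatives are taken in [1, P], not in [0, P - 1], since colliding integers must be
    positive. *)
Definition repr_mod P t := ((t + P.-1) %% P).+1.

Lemma repr_modP P t : 0 < P -> repr_mod P t = t %[mod P].
Proof.
move=> P0; rewrite /repr_mod -addn1 modnDml -addnA addn1 prednK //.
by rewrite modnDr.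
Qed.

Lemma repr_mod_le P t : 0 < P -> 0 < repr_mod P t <= P.
Proof. by move=> P0; rewrite /repr_mod /= ltn_mod. Qed.

Lemma split_mod_repr h P : 0 < P -> 0 < h -> coprime h P -> split_mod P ->
  exists u v w, [/\ [/\ 0 < u <= P, 0 < v <= P & 0 < w <= P],
    [/\ u != v, v != w & u != w], u + v + w = P \/ u + v + w = P.*2 &
    cubic (h * u) = cubic (h * v) %[mod P] /\
    cubic (h * v) = cubic (h * w) %[mod P]].
Proof.
move=> P0 h0 cop [a [b [q ab abb aab]]].
have [h' hh'] : exists h', h * h' = 1 %[mod P].
  have [k l E _] := egcdnP P h0; exists k.
  by rewrite mulnC E (eqP cop) modnMDl.
have hr t : h * repr_mod P (h' * t) = t %[mod P].
  by rewrite -modnMmr repr_modP // modnMmr mulnA -modnMml hh' modnMml mul1n.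
pose c := (a + b) * P.-1.
have abc : P %| a + b + c.
  by rewrite /c -mulnS prednK // dvdn_mull.
set u := repr_mod P (h' * a); set v := repr_mod P (h' * b).
set w := repr_mod P (h' * c).
have Eu : h * u = a %[mod P] by apply: hr.
have Ev : h * v = b %[mod P] by apply: hr.
have Ew : h * w = c %[mod P] by apply: hr.
have uv : u != v by apply: contraNneq ab => E; rewrite -Eu -Ev E.
have vw : v != w.
  apply: contraNN abb => /eqP E; rewrite -addnn addnA.
  by rewrite /dvdn -modnDmr -Ev E Ew modnDmr.
have uw : u != w.
  apply: contraNN aab => /eqP E; rewrite -addnn addnAC -addnA addnCA addnA.
  rewrite /dvdn -modnDmr -Eu E Ew modnDmr; move: abc; rewrite /dvdn => /eqP <-.
  by apply/eqP; congr (_ %% _); lia.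
have uP : 0 < u <= P by apply: repr_mod_le.
have vP : 0 < v <= P by apply: repr_mod_le.
have wP : 0 < w <= P by apply: repr_mod_le.
clearbody u v w c; exists u, v, w; split=> //.
- have : P %| u + v + w.
    have cPh : coprime P h by rewrite coprime_sym.
    rewrite -(Gauss_dvdr _ cPh) !mulnDr /dvdn.
    rewrite -modnDm -(modnDm (h * u)) Eu Ev Ew !modnDm -modnDml modnDm modnDml.
    by move: abc; rewrite /dvdn.
  move=> /dvdnP[k E]; clear -uP vP wP uv vw uw E.
  (* k = 0 contradicts positivity, k = 3 would force u = v = w = P, and k > 3 exceeds the bound
     3P. *)
  case: k E => [|[|[|[|k]]]] E.
  + by lia.
  + by left; lia.
  + by right; lia.
  + by exfalso; lia.
  + by exfalso; move: (leq_mul2r P 4 k.+4) => /=; rewrite -E; lia.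
split; apply: quad_cubic; rewrite /dvdn.
  by rewrite (quad_eqmod Eu Ev).
by rewrite (quad_eqmod Ev Ew) -/(dvdn _ _); apply: quad_third_root q.
Qed.

(* Among representatives of the three roots in [1, P], whose sum is prime to 3,
   two are congruent mod 3. *)
Lemma collides_mul3 n P e : 0 < P -> 0 < e -> 3 %| e -> ~~ (3 %| P) ->
  coprime P e -> split_mod P -> P * e <= 3 * n -> collides n (P * e).
Proof.
move=> P0 e0 /dvdnP[h eE] P3 cop sp le; rewrite {}eE in e0 cop le *.
have h0 : 0 < h by lia.
have cop' : coprime h P by move: cop; rewrite coprimeMr coprime_sym => /andP[].
have [u [v [w [[uP vP wP] [uv vw uw] S [Euv Evw]]]]] := split_mod_repr P0 h0 cop' sp.
have key x y : 0 < x <= P -> 0 < y <= P -> x != y -> x = y %[mod 3] ->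
    cubic (h * x) = cubic (h * y) %[mod P] -> collides n (P * (h * 3)).
  move=> /andP[x0 xP] /andP[y0 yP] xy xy3 E.
  have hn z : z <= P -> h * z <= n.
    by move=> /(leq_mul (leqnn h)); clear -le; lia.
  apply: (@collides_cubic _ _ (h * x) (h * y)); rewrite ?muln_gt0 ?h0 ?hn //.
    by rewrite eqn_pmul2l.
  apply/eqP; rewrite chinese_remainder //; apply/andP; split; first exact/eqP.
  apply/eqP/cubic_eqmod_arg; rewrite -!muln_modr; congr (_ * _).
  exact: xy3.
have [xy|/eqP xy] := altP (@eqP _ (u %% 3) (v %% 3)); first exact: key Euv.
have [yz|/eqP yz] := altP (@eqP _ (v %% 3) (w %% 3)); first exact: key Evw.
have [xz|/eqP xz] := altP (@eqP _ (u %% 3) (w %% 3)).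
  by apply: key xz _ => //; rewrite Euv.
by exfalso; move: P3; rewrite /dvdn; clear -S xy yz xz; lia.
Qed.

(** * Counting values modulo m *)

Definition vals m := undup [seq cubic a %% m | a <- iota 0 m].

Definition nvals m := size (vals m).

Lemma mem_vals m a : 0 < m -> cubic a %% m \in vals m.
Proof.
move=> m0; rewrite mem_undup; apply/mapP; exists (a %% m).
  by rewrite mem_iota add0n ltn_mod.
by rewrite cubic_mod.
Qed.

Lemma valsP m x : x \in vals m -> exists2 a, a < m & x = cubic a %% m.
Proof. by rewrite mem_undup => /mapP[a]; rewrite mem_iota => /andP[_ am] ->; exists a. Qed.

(** By the Chinese remainder theorem, two elements of s with the same value modulo Q collide modulo
    P Q. *)
Lemma collides_pigeonhole n P Q s : 0 < Q -> coprime P Q -> uniq s ->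
  {in s, forall a, 0 < a <= n} ->
  {in s &, forall a b, cubic a = cubic b %[mod P]} ->
  nvals Q < size s -> collides n (P * Q).
Proof.
move=> Q0 cop us sn sP; rewrite ltnNge => /negP H.
apply/distinct_modPn/negP => D; apply: H.
rewrite -(size_map (fun a => cubic a %% Q)); apply: uniq_leq_size; last first.
  by move=> x /mapP[a _ ->]; apply: mem_vals.
rewrite map_inj_in_uniq // => a b sa sb E; apply/eqP/negPn/negP => ab.
move: D; apply/negP/distinct_modPn.
have /andP[a0 an] := sn _ sa; have /andP[b0 bn] := sn _ sb.
apply: collides_cubic ab _ => //; apply/eqP.
by rewrite chinese_remainder // E eqxx (sP a b sa sb) eqxx.
Qed.

(** A value modulo Q is determined by its residue modulo p, which is a value modulo p, and by its
    quotient by p, which is less than Q/p. *)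
Lemma nvals_dvd p Q : 0 < Q -> p %| Q -> nvals Q <= Q %/ p * nvals p.
Proof.
move=> Q0 pQ; have p0 := dvdn_gt0 Q0 pQ.
pose s := [seq v + p * k | v <- vals p, k <- iota 0 (Q %/ p)].
apply: (@leq_trans (size s)); last by rewrite size_allpairs size_iota mulnC.
apply: uniq_leq_size; first exact: undup_uniq.
move=> x /valsP[a aQ ->]; apply/allpairsP.
exists (cubic a %% p, (cubic a %% Q) %/ p); split; first exact: mem_vals.
  by rewrite mem_iota add0n leq0n ltn_divLR // divnK // ltn_mod.
by rewrite /= -{1}(divnK pQ) -(modn_dvdm _ pQ) divnK // mulnC addnC -divn_eq.
Qed.

Lemma cubic_even a : ~~ odd (cubic a).
Proof. by rewrite /cubic oddD oddX /= addbb. Qed.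

Lemma nvals_even Q : 2 %| Q -> (nvals Q).*2 <= Q.
Proof.
case: (posnP Q) => [-> //|Q0 Q2].
have : nvals Q <= size [seq k.*2 | k <- iota 0 (Q %/ 2)].
  apply: uniq_leq_size; first exact: undup_uniq.
  move=> x /valsP[a aQ ->]; apply/mapP; exists (cubic a %% Q %/ 2).
    by rewrite mem_iota add0n leq0n ltn_divLR // divnK // ltn_mod.
  rewrite divn2 even_halfK // odd_mod; first exact: cubic_even.
  by rewrite -[odd Q]negbK -dvdn2 Q2.
rewrite size_map size_iota => H.
by rewrite -{2}(divnK Q2) muln2 leq_double.
Qed.

(** Dropping two of the three roots of a split value from [0, P - 1] loses no value. *)
Lemma nvals_split P : 0 < P -> split_mod P -> nvals P + 2 <= P.
Proof.
move=> P0 /(split_mod_repr P0 (isT : 0 < 1)).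
rewrite coprime1n => /(_ isT)[u [v [w [[uP vP wP] [uv vw uw] _ []]]]].
rewrite !mul1n => Euv Evw.
have inj x y : 0 < x <= P -> 0 < y <= P -> x != y -> x %% P != y %% P.
  move=> /andP[x0 xP] /andP[y0 yP] xy.
  move: xP yP xy; rewrite leq_eqVlt => /orP[/eqP->|xP]; rewrite leq_eqVlt => /orP[/eqP->|yP] xy.
  - by rewrite eqxx in xy.
  - by rewrite modnn modn_small // neq_ltn y0.
  - by rewrite modnn modn_small // neq_ltn x0 orbT.
  - by rewrite !modn_small.
pose s := rem (w %% P) (rem (v %% P) (iota 0 P)).
have in_i x : x %% P \in iota 0 P by rewrite mem_iota ltn_mod.
have us : uniq (rem (v %% P) (iota 0 P)) by rewrite rem_uniq ?iota_uniq.
have sE : size s = P - 2.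
  rewrite /s !size_rem ?size_iota ?subn2 // mem_rem_uniq ?iota_uniq // !inE in_i.
  by rewrite eq_sym inj.
have P2 : 2 <= P.
  by clear -uP vP uv; lia.
have : nvals P <= size [seq cubic a %% P | a <- s].
  apply: uniq_leq_size; first exact: undup_uniq.
  move=> x /valsP[a aP ->].
  have in_s b : b < P -> b != v %% P -> b != w %% P -> b \in s.
    move=> bP bv bw; rewrite mem_rem_uniq // !inE bw mem_rem_uniq ?iota_uniq // !inE bv.
    by rewrite mem_iota.
  have us' : cubic (u %% P) %% P \in [seq cubic a %% P | a <- s].
    by apply: map_f; apply: in_s; rewrite ?ltn_mod ?inj.
  have [->|av] := eqVneq a (v %% P).
    by rewrite cubic_mod -Euv -cubic_mod.
  have [->|aw] := eqVneq a (w %% P).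
    by rewrite cubic_mod -Evw -Euv -cubic_mod.
  by apply: map_f; apply: in_s.
by rewrite size_map sE; clear -P2; lia.
Qed.

Lemma eq_add_mul P x y k l : 0 < x <= P -> 0 < y <= P ->
  x + P * k = y + P * l -> x = y /\ k = l.
Proof.
case: x y => [|x] [|y] // xP yP; rewrite !addSn => -[E].
have P0 : 0 < P by apply: leq_trans xP.
have kl : k = l.
  have := congr1 (divn^~ P) E.
  by rewrite !(addnC _ (P * _)) !(mulnC P) !divnMDl // !divn_small ?addn0.
by move: E; rewrite kl => /addIn ->.
Qed.

(* Take the elements of [1, n] in the three residue classes of a split value
   modulo [P]: there are about [Q] of them, and [cubic] is constant mod [P] on
   them. *)
Lemma collides_coprime n P Q : 0 < P -> 0 < Q -> coprime P Q -> ~~ (3 %| Q) ->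
  split_mod P -> nvals Q + 2 <= Q -> P * Q <= 3 * n -> collides n (P * Q).
Proof.
move=> P0 Q0 cop Q3 /(split_mod_repr P0 (isT : 0 < 1)).
rewrite coprime1n => /(_ isT)[u [v [w [[uP vP wP] [uv vw uw] S []]]]].
rewrite !mul1n => Euv Evw nQ le.
pose t := [:: u; v; w].
have tP x : x \in t -> 0 < x <= P.
  by rewrite !inE => /or3P[] /eqP->.
have tE x k : x \in t -> cubic (x + P * k) = cubic u %[mod P].
  move=> xt; rewrite (@cubic_eqmod_arg _ _ x); last by rewrite addnC mulnC modnMDl.
  by move: xt; rewrite !inE => /or3P[] /eqP->; rewrite -?Evw -?Euv.
have ut : uniq t by rewrite /= !inE negb_or uv uw vw.
(* The sum is at most 2P, so some representative is at most 2P/3. It provides the extra element m0 +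
   P q when Q = 3q + 2. *)
have [m0 m0t m0P] : exists2 x, x \in t & 3 * x <= 2 * P.
  have [hu|hu] := leqP (3 * u) (2 * P); first by exists u; rewrite // !inE eqxx.
  have [hv|hv] := leqP (3 * v) (2 * P); first by exists v; rewrite ?inE ?eqxx ?orbT.
  exists w; rewrite ?inE ?eqxx ?orbT //.
  by clear -S hu hv; lia.
pose q := Q %/ 3.
pose s := [seq x + P * k | x <- t, k <- iota 0 q].
have szs : size s = 3 * q by rewrite size_allpairs size_iota.
have qn x k : 0 < x <= P -> k < q -> 0 < x + P * k <= n.
  move=> /andP[x0 xP] kq; rewrite addn_gt0 x0 /=.
  have : P * q <= n.
    by rewrite -(@leq_pmul2l 3) // (leq_trans _ le) // mulnCA leq_mul2l mulnC leq_trunc_div orbT.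
  apply: leq_trans; apply: leq_trans (_ : P * k.+1 <= _); last by rewrite leq_mul2l kq orbT.
  by rewrite mulnS leq_add2r.
have us : uniq s.
  apply: allpairs_uniq => //; first exact: iota_uniq.
  move=> [x k] [y l] /allpairsP[[x1 k1] [xt kq [-> ->]]] /allpairsP[[y1 l1] [yt lq [-> ->]]].
  rewrite /uncurry => E.
  by have [/= -> ->] := eq_add_mul (tP _ xt) (tP _ yt) E.
have sn : {in s, forall a, 0 < a <= n}.
  move=> a /allpairsP[[x k] [xt]]; rewrite mem_iota add0n => /andP[_ kq] ->.
  by apply: qn => //; apply: tP.
have sc : {in s, forall a, cubic a = cubic u %[mod P]}.
  by move=> a /allpairsP[[x k] [xt _ ->]]; apply: tE.
have Qr : Q = 3 * q + Q %% 3 by rewrite mulnC -divn_eq.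
have : Q %% 3 = 1 \/ Q %% 3 = 2.
  by move: Q3; rewrite /dvdn; have := ltn_pmod Q (isT : 0 < 3); clear; lia.
(* Either way Q - 1 elements face at most Q - 2 values: the 3q elements of s, with one more when Q =
   3q + 2. *)
case=> r; rewrite r in Qr.
  apply: collides_pigeonhole us sn _ _ => //.
    by move=> a b sa sb; rewrite !sc.
  by rewrite szs; clear -Qr nQ; lia.
apply: (@collides_pigeonhole _ _ _ (m0 + P * q :: s)) => //.
- rewrite /= us andbT; apply/negP => /allpairsP[[x k] [xt]].
  rewrite mem_iota add0n => /andP[_ kq] E.
  have [_ qk] := eq_add_mul (tP _ m0t) (tP _ xt) E.
  by move: kq; rewrite qk ltnn.
- move=> a; rewrite inE => /orP[/eqP->|]; last exact: sn.
  have /andP[m00 _] := tP _ m0t; rewrite addn_gt0 m00 /=.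
  have : 3 * (m0 + P * q) <= P * Q by rewrite Qr; clear -m0P; lia.
  by move=> /leq_trans/(_ le); rewrite leq_pmul2l.
- have sc' : {in m0 + P * q :: s, forall a, cubic a = cubic u %[mod P]}.
    by move=> a; rewrite inE => /orP[/eqP->|]; [apply: tE | apply: sc].
  by move=> a b sa sb; rewrite !sc'.
by rewrite /= szs; clear -Qr nQ; lia.
Qed.

(* Hensel: [a] is a simple root of [quad _ b] since [p] does not divide 2a + b. *)
Lemma split_mod_lift p i : prime p -> split_mod p -> split_mod (p ^ i.+1).
Proof.
move=> pp [a [b [q ab abb aab]]].
have p0 := prime_gt0 pp.
have dbl x : x = a %[mod p] -> x.*2 = a.*2 %[mod p].
  by move=> E; rewrite -!muln2 -modnMml E modnMml.
have [a' [Ea qa]] : exists a', a' = a %[mod p] /\ p ^ i.+1 %| quad a' b.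
  elim: i => [|i [a' [Ea /dvdnP[c qE]]]]; first by exists a; rewrite expn1.
  have d0 : 0 < a'.*2 + b.
    by case: (a') Ea aab => [|//]; case: (b) ab => // /[swap] <-; rewrite eqxx.
  have cop : coprime (a'.*2 + b) p.
    rewrite coprime_sym prime_coprime //; apply: contraNN aab.
    by rewrite /dvdn -modnDml (dbl _ Ea) modnDml.
  have [k l E _] := egcdnP p d0; rewrite (eqP cop) in E.
  (* Newton's correction: k inverts 2a' + b modulo p, so t is -c/(2a' + b). *)
  have [t Et] : exists t, p %| c + t * (a'.*2 + b).
    exists (c * k * p.-1).
    have -> : c + c * k * p.-1 * (a'.*2 + b) = c + c * p.-1 * (k * (a'.*2 + b)) by ring.
    have -> : c + c * p.-1 * (k * (a'.*2 + b)) = c * p + c * p.-1 * l * p.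
      by rewrite E; case: (p) p0 => // p' _; rewrite succnK; ring.
    by rewrite dvdn_add ?dvdn_mull.
  exists (a' + p ^ i.+1 * t); split.
    by rewrite expnS -mulnA mulnC addnC modnMDl.
  have -> : quad (a' + p ^ i.+1 * t) b =
     p ^ i.+1 * (c + t * (a'.*2 + b)) + p ^ i.+2 * (p ^ i * t ^ 2).
    have -> : quad (a' + p ^ i.+1 * t) b =
       quad a' b + p ^ i.+1 * (t * (a'.*2 + b)) + (p ^ i.+1 * t) ^ 2.
      rewrite /quad -addnn; ring.
    by rewrite qE !expnS; ring.
  by apply: dvdn_add; [rewrite [X in X %| _]expnSr dvdn_mul | exact: dvdn_mulr].
have pdvd := dvdn_exp (ltn0Sn i) (dvdnn p).
exists a', b; split=> //.
- by apply: contraNN ab => /eqP E; rewrite -Ea -(modn_dvdm a' pdvd) E modn_dvdm.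
- apply: contraNN abb => /(dvdn_trans pdvd).
  by rewrite /dvdn -modnDml Ea modnDml.
- apply: contraNN aab => /(dvdn_trans pdvd).
  by rewrite /dvdn -modnDml (dbl _ Ea) modnDml.
Qed.

(** * Moduli 7 * 3 ^ j *)

Lemma expn3_mod7 j : 3 ^ j %% 7 = nth 0 [:: 1; 3; 2; 6; 4; 5] (j %% 6).
Proof.
rewrite {1}(divn_eq j 6) expnD [_ * 6]mulnC expnM -modnMml -modnXm.
rewrite (_ : 3 ^ 6 %% 7 = 1) // exp1n mul1n.
by case: (j %% 6) (ltn_pmod j (isT : 0 < 6)) => [|[|[|[|[|[|r]]]]]].
Qed.

(** The difference y 3^j absorbs the power of 3; only Q modulo 7 remains, where 3^j may be replaced
    by c. *)
Lemma collides_7_witness j n a y c : 3 ^ j %% 7 = c -> 0 < a -> 0 < y ->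
  a + y * 3 ^ j <= n -> 7 %| quad a (a + y * c) -> collides n (7 * 3 ^ j).
Proof.
move=> jc a0 y0 le dv; have t0 : 0 < 3 ^ j by rewrite expn_gt0.
exists a, (a + y * 3 ^ j); split=> //.
  by rewrite -addn1 leq_add2l muln_gt0 y0.
rewrite addKn mulnC dvdn_mul ?dvdn_mull // /dvdn.
rewrite (@quad_eqmod 7 a a _ (a + y * c)) //.
by rewrite -jc -modnDmr -[in RHS]modnDmr modnMmr.
Qed.

(** Each class of j modulo 6 has an explicit pair a, a + y 3^j. It ends by 3^(j+1) + 1, except for j
    = 4 modulo 6, where it ends at 3^(j+1) + 3. *)
Lemma collides_7_pow3 j n : 3 ^ j.+1 < n ->
  collides n (7 * 3 ^ j) \/ j %% 6 = 4 /\ n <= 3 ^ j.+1 + 2.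
Proof.
rewrite expnS => nj; have t0 : 0 < 3 ^ j by rewrite expn_gt0.
have wit c a y := @collides_7_witness j n a y c.
have := expn3_mod7 j.
case: (j %% 6) (ltn_pmod j (isT : 0 < 6)) => [|[|[|[|[|[|r]]]]]] //= _ jc.
- by left; apply: (wit _ 1 2 jc) => //; lia.
- by left; apply: (wit _ 1 3 jc) => //; lia.
- by left; apply: (wit _ 1 1 jc) => //; lia.
- have [j0|j0] := posnP j; first by rewrite j0 in jc.
  have : 3 <= 3 ^ j by apply: (@leq_pexp2l 3 1).
  by left; apply: (wit _ 3 2 jc) => //; lia.
- have [le|lt] := leqP n (3 * 3 ^ j + 2); first by right.
  by left; apply: (wit _ 3 3 jc) => //; lia.
- have [j0|j0] := posnP j; first by rewrite j0 in jc.
  have : 3 <= 3 ^ j by apply: (@leq_pexp2l 3 1).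
  by left; apply: (wit _ 3 1 jc) => //; lia.
Qed.

(** A collision has b - a = y 3^j with 0 < y < 4, so 7 divides Q(a, a + 4y). For y = 1, 2 no residue
    of a works; y = 3 leaves only a = 1, 2, which fail too. *)
Lemma not_collides_7_pow3 j n : j %% 6 = 4 -> n <= 3 ^ j.+1 + 2 ->
  ~ collides n (7 * 3 ^ j).
Proof.
move=> j4; have := expn3_mod7 j; rewrite {}j4 /= => jc; rewrite expnS => nj.
move=> [a [b [a0 ab bn]]] dv.
have t4 : 4 <= 3 ^ j by rewrite -jc leq_mod.
have : 3 ^ j %| b - a.
  rewrite -(@Gauss_dvdl _ _ (quad a b)) ?coprimeXl ?coprime3_quad //.
  by apply: dvdn_trans dv; rewrite dvdn_mull.
move=> /dvdnP[y yE].
have bE : b = a + y * 3 ^ j by rewrite -yE subnKC // ltnW.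
have y0 : 0 < y by case: (y) yE => // /eqP; rewrite mul0n subn_eq0 leqNgt ab.
have y4 : y < 4.
  by rewrite -(@ltn_pmul2r (3 ^ j)) -?yE; clear -bn nj a0 t4 ab; lia.
have {dv} : 7 %| quad a b.
  have c7 : coprime 7 (b - a).
    rewrite yE coprimeMr coprimeXr // andbT.
    by case: (y) y0 y4 => [|[|[|[|]]]].
  by rewrite -(Gauss_dvdr _ c7) (dvdn_trans _ dv) // dvdn_mulr.
rewrite /dvdn (@quad_eqmod 7 _ (a %% 7) _ ((a %% 7) + y * 4)) ?modn_mod //; last first.
  by rewrite bE -modnDmr -modnMmr jc modnDmr modnDml.
have a3 : y = 3 -> a < 3 by move=> y3; move: bE; rewrite y3; clear -bn nj; lia.
case: y y0 y4 a3 {yE bE} => [|[|[|[|]]]] // _ _ a3.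
- by case: (a %% 7) (ltn_pmod a (isT : 0 < 7)) => [|[|[|[|[|[|[|]]]]]]].
- by case: (a %% 7) (ltn_pmod a (isT : 0 < 7)) => [|[|[|[|[|[|[|]]]]]]].
by have := a3 erefl; clear -a0; case: a a0 => [|[|[|]]].
Qed.

(** * Values of x^3 + x over a finite field *)

Import GRing.Theory.
Local Open Scope ring_scope.

Lemma cards3 (T : finType) (x y z : T) :
  x != y -> y != z -> x != z -> #|[set x; y; z]| = 3%N.
Proof.
move=> xy yz xz.
by rewrite setUC cardsU1 !inE cards2 negb_or ![z == _]eq_sym xy yz xz.
Qed.

Section FiberSums.

Variables (T U : finType) (f : T -> U) (A : {set T}).

Lemma card_imset_fibers :
  (#|A| = \sum_(v in f @: A) #|[set x in A | f x == v]|)%N.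
Proof.
rewrite -sum1_card (partition_big_imset f); apply: eq_bigr => v _.
by rewrite -sum1_card; apply: eq_bigl => x; rewrite inE.
Qed.

Lemma leq_card_imset_fibers k :
  (forall x, x \in A -> #|[set y in A | f y == f x]| <= k)%N ->
  (#|A| <= k * #|f @: A|)%N.
Proof.
move=> H; rewrite card_imset_fibers mulnC -sum_nat_const.
by apply: leq_sum => v /imsetP[x xA ->]; apply: H.
Qed.

Lemma geq_card_imset_fibers k :
  (forall x, x \in A -> k <= #|[set y in A | f y == f x]|)%N ->
  (k * #|f @: A| <= #|A|)%N.
Proof.
move=> H; rewrite card_imset_fibers mulnC -sum_nat_const.
by apply: leq_sum => v /imsetP[x xA ->]; apply: H.
Qed.

End FiberSums.

Section FiniteField.

Variable K : finFieldType.

Definition fcubic (x : K) := x ^+ 3 + x.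
Definition fquad (x y : K) := x ^+ 2 + x * y + y ^+ 2 + 1.

Lemma fcubicB x y : fcubic x - fcubic y = (x - y) * fquad x y.
Proof. by rewrite /fcubic /fquad; ring. Qed.

Lemma fcubic_eq x y : (fcubic x == fcubic y) = (x == y) || (fquad x y == 0).
Proof. by rewrite -subr_eq0 fcubicB mulf_eq0 subr_eq0. Qed.

(** X^k - 1 has at most k roots, fewer than there are nonzero elements. *)
Lemma exists_expf_neq1 k : (0 < k)%N -> (k < #|K|.-1)%N ->
  exists2 c : K, c != 0 & c ^+ k != 1.
Proof.
move=> k0 kK.
case: (boolP [exists c : K, (c != 0) && (c ^+ k != 1)]) => [/existsP[c /andP[]]|].
  by exists c.
rewrite negb_exists => /forallP H.
have : (size (enum [set~ (0%R : K)]) <= k)%N.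
  apply: max_unity_roots => //; last exact: enum_uniq.
  apply/allP => c; rewrite mem_enum !inE => c0; apply/unity_rootP.
  by have := H c; rewrite c0 /= negbK => /eqP.
by rewrite -cardE cardsC1 leqNgt kK.
Qed.

Lemma sum_expf k : (0 < k)%N -> (k < #|K|.-1)%N -> \sum_(x : K) x ^+ k = 0.
Proof.
move=> k0 kK; have [c c0 ck] := exists_expf_neq1 k0 kK.
set S := \sum_x _; have : c ^+ k * S = S.
  rewrite /S [RHS](reindex (fun x => c * x)) /=; last first.
    by exists (fun x => c^-1 * x) => x _; rewrite ?mulKf ?mulVKf.
  by rewrite mulr_sumr; apply: eq_bigr => x _; rewrite exprMn.
by move=> /eqP; rewrite -subr_eq0 -{2}[S]mul1r -mulrBl mulf_eq0 subr_eq0 (negPf ck) => /eqP.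
Qed.

Lemma natf_card0 : #|K|%:R = 0 :> K.
Proof.
apply: (addIr (\sum_(x : K) x)); rewrite add0r.
rewrite [in RHS](reindex (fun x => 1 + x)) /=; last first.
  by exists (fun x => x - 1) => x _; ring.
by rewrite big_split /= sumr_const.
Qed.

Hypotheses (two_neq0 : 2%:R != 0 :> K) (three_neq0 : 3%:R != 0 :> K).

Definition is_square (a : K) := [exists x : K, a == x ^+ 2].

(** Squaring is at most two-to-one, so the squares S fill at least half of the nonzero elements U.
    The disjoint coset a S is then the rest of U, and contains b. *)
Lemma is_squareM_nonsquare a b : ~~ is_square a -> ~~ is_square b -> is_square (a * b).
Proof.
move=> na nb; pose U := [set~ (0%R : K)]; pose S := [set x ^+ 2 | x in U].
have a0 : a != 0.
  by apply: contraNneq na => ->; apply/existsP; exists 0; rewrite expr0n.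
have b0 : b != 0.
  by apply: contraNneq nb => ->; apply/existsP; exists 0; rewrite expr0n.
have SU : S \subset U.
  by apply/subsetP => y /imsetP[x]; rewrite !inE => x0 ->; rewrite expf_neq0.
have sS : (#|U| <= 2 * #|S|)%N.
  apply: leq_card_imset_fibers => x _.
  apply: leq_trans (_ : #|[set x; - x]| <= 2)%N; last by rewrite cards2; case: (_ != _).
  apply: subset_leq_card; apply/subsetP => y; rewrite !inE => /andP[_].
  by rewrite eqf_sqr.
have aU : [set a * y | y in S] \subset U.
  apply/subsetP => z /imsetP[y /(subsetP SU)]; rewrite !inE => y0 ->.
  by rewrite mulf_neq0.
have ca : #|[set a * y | y in S]| = #|S| by rewrite card_imset //; apply: mulfI.
have dis : [disjoint S & [set a * y | y in S]].
  apply/pred0P => z /=; apply/negP => /andP[/imsetP[x _ ->] /imsetP[_ /imsetP[w w0 ->] E]].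
  rewrite !inE in w0.
  move: na; apply/negP; rewrite negbK; apply/existsP; exists (x / w).
  by rewrite expr_div_n E mulfK // expf_neq0.
have full : S :|: [set a * y | y in S] = U.
  apply/eqP; rewrite eqEcard subUset SU aU /=.
  move: dis; rewrite -setI_eq0 => /eqP dis.
  by rewrite cardsU dis cards0 subn0 ca addnn -mul2n.
have : b \in U by rewrite !inE.
rewrite -full inE => /orP[/imsetP[x _ E]|/imsetP[_ /imsetP[x _ ->] ->]].
  by move: nb; rewrite E => /negP[]; apply/existsP; exists x.
by apply/existsP; exists (a * x); rewrite exprMn expr2 mulrA.
Qed.

(* Cardano's substitution: [fcubic (xpar s) = hpar s] for [s != 0]; when -3 is a
   square, the values with several preimages are exactly those of [hpar]. *)
Definition xpar (s : K) := s - (3%:R * s)^-1.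
Definition hpar (s : K) := s ^+ 3 - (27%:R * s ^+ 3)^-1.

Lemma four_neq0 : 4%:R != 0 :> K.
Proof. by rewrite (_ : 4%:R = 2%:R * 2%:R) ?mulf_neq0 //; ring. Qed.

Lemma six_neq0 : 6%:R != 0 :> K.
Proof. by rewrite (_ : 6%:R = 2%:R * 3%:R) ?mulf_neq0 //; ring. Qed.

Lemma twelve_neq0 : 12%:R != 0 :> K.
Proof. by rewrite (_ : 12%:R = 2%:R * (2%:R * 3%:R)) ?mulf_neq0 //; ring. Qed.

(** * Fields with 2 modulo 3 elements *)

Section CardTwoModThree.

Hypothesis card2 : (#|K| %% 3 = 2)%N.

(** If w^2 = -3, then o = (w - 1)/2 is a cube root of unity. As |K| = 2 modulo 3, o = o^|K| = o^2,
    so o = 1; but then o^2 + o + 1 = 3 is not 0. *)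
Lemma nonsquare_m3 : ~~ is_square (- 3%:R : K).
Proof.
apply/existsP => -[w /eqP E].
pose o := (w - 1) / 2%:R.
have o2 : o ^+ 2 + o + 1 = 0.
  have -> : o ^+ 2 + o + 1 = (w ^+ 2 + 3%:R) / 4%:R.
    by rewrite /o; field; rewrite two_neq0 four_neq0.
  by rewrite -E addNr mul0r.
have o3 : o ^+ 3 = 1.
  apply/eqP; rewrite -subr_eq0 (_ : _ - _ = (o - 1) * (o ^+ 2 + o + 1)); last by ring.
  by rewrite o2 mulr0.
have o1 : o ^+ 2 = o.
  by rewrite -[RHS]expf_card (divn_eq #|K| 3) card2 exprD mulnC exprM o3 expr1n mul1r.
have o_1 : o = 1.
  have o0 : o != 0 by apply/eqP => o0; move: o3 => /eqP; rewrite o0 expr0n eq_sym oner_eq0.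
  by apply: (mulfI o0); rewrite -expr2 o1 mulr1.
by move: o2; rewrite o_1 (_ : _ + 1 = 3%:R) => [/eqP|]; [rewrite (negPf three_neq0) | ring].
Qed.

(** Q(x, Y) has discriminant -3x^2 - 4, while x = [xpar s] reads 3s^2 - 3xs - 1 = 0, of discriminant
    9x^2 + 12. The latter is -3 times the former, and -3 is not a square; so if the latter is not a
    square, the former is one. *)
Lemma fquad_nonpar x : (forall s, s != 0 -> x != xpar s) -> exists y, fquad x y = 0.
Proof.
move=> nx.
have n1 : ~~ is_square (9%:R * x ^+ 2 + 12%:R).
  apply/existsP => -[w /eqP E].
  (* The product of w - 3x and w + 3x is 12, so some choice of the sign of w makes the root s
     nonzero. *)
  have : w - 3%:R * x != 0 \/ w + 3%:R * x != 0.
    have [E1|] := eqVneq (w - 3%:R * x) 0; last by left.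
    have [E2|] := eqVneq (w + 3%:R * x) 0; last by right.
    have := twelve_neq0; rewrite (_ : 12%:R = (w - 3%:R * x) * (w + 3%:R * x)).
      by rewrite E1 mul0r eqxx.
    by rewrite (_ : _ * _ = w ^+ 2 - 9%:R * x ^+ 2); [rewrite -E; ring | ring].
  have key z : z ^+ 2 = 9%:R * x ^+ 2 + 12%:R -> z + 3%:R * x != 0 -> False.
    move=> Ez z0; pose s := (z + 3%:R * x) / 6%:R.
    have s0 : s != 0 by rewrite mulf_neq0 ?invr_eq0 ?six_neq0.
    have /eqP[] := nx s s0.
    apply: (mulfI (mulf_neq0 three_neq0 s0)); rewrite /xpar mulrBr divff; last first.
      by rewrite mulf_neq0.
    apply/eqP; rewrite -subr_eq0; apply/eqP.
    have -> : 3%:R * s * x - (3%:R * s * s - 1) = (9%:R * x ^+ 2 + 12%:R - z ^+ 2) / 12%:R.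
      by rewrite /s; field; rewrite six_neq0 twelve_neq0.
    by rewrite Ez subrr mul0r.
  case=> h; [apply: (key (- w)) | apply: (key w)] => //; rewrite ?sqrrN -?E //.
  by rewrite -oppr_eq0 opprD opprK.
have /existsP[w /eqP Ew] := is_squareM_nonsquare nonsquare_m3 n1.
exists ((w / 3%:R - x) / 2%:R).
have -> : fquad x ((w / 3%:R - x) / 2%:R) = (w ^+ 2 + 27%:R * x ^+ 2 + 36%:R) / 36%:R.
  rewrite /fquad; field.
  by rewrite two_neq0 three_neq0 (_ : 36%:R = 6%:R * 6%:R) ?mulf_neq0 ?six_neq0 //; ring.
by rewrite -Ew; apply/eqP; rewrite mulf_eq0; apply/orP; left; apply/eqP; ring.
Qed.

Lemma three_sqr_add1_neq0 (x : K) : 3%:R * x ^+ 2 + 1 != 0.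
Proof.
apply/eqP => E; have /existsP[] := nonsquare_m3; exists (3%:R * x).
rewrite -subr_eq0; have -> : - 3%:R - (3%:R * x) ^+ 2 = - 3%:R * (3%:R * x ^+ 2 + 1) by ring.
by rewrite E mulr0.
Qed.

Lemma fquad_distinct x y : fquad x y = 0 ->
  [/\ x != y, x + y *+ 2 != 0 & x *+ 2 + y != 0].
Proof.
move=> E; have nx a b : fquad a b = 0 -> a *+ 2 + b != 0.
  move=> Eab; apply/eqP => s0; have := three_sqr_add1_neq0 a.
  rewrite -Eab (_ : b = - (a *+ 2)); last by apply/eqP; rewrite -addr_eq0 addrC s0.
  by move=> /eqP[]; rewrite /fquad; ring.
split; last exact: nx.
  apply/eqP => xy; have := three_sqr_add1_neq0 x.
  by rewrite -E -xy => /eqP[]; rewrite /fquad; ring.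
by rewrite addrC; apply: nx; rewrite -E /fquad; ring.
Qed.

(** s and -1/(3s) have the same image, and they differ because 3s^2 + 1 is not 0. *)
Lemma card_xpar : (2 * #|[set xpar s | s in [set~ 0%R]]| <= #|K|.-1)%N.
Proof.
rewrite -(cardsC1 (0%R : K)); apply: geq_card_imset_fibers => s; rewrite !inE => s0.
pose t := - (3%:R * s)^-1.
have t0 : t != 0 by rewrite oppr_eq0 invr_eq0 mulf_neq0.
have st : s != t.
  apply/eqP => E; have := three_sqr_add1_neq0 s.
  have -> : 3%:R * s ^+ 2 + 1 = 0; last by rewrite eqxx.
  by rewrite expr2 mulrA {2}E /t mulrN divff ?mulf_neq0 // addNr.
apply: leq_trans (_ : 2 <= #|[set s; t]|)%N _; first by rewrite cards2 st.
apply: subset_leq_card; apply/subsetP => y; rewrite !inE => /orP[]/eqP->.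
  by rewrite s0 eqxx.
rewrite t0 /xpar /t /=; apply/eqP; field.
by rewrite s0 three_neq0 oppr_eq0 oner_eq0.
Qed.

(** Elements of S lie in fibers of at least three elements. The complement of S is contained in the
    image of [xpar], so it has at most (|K| - 1)/2 elements. Hence there are at most (|K| + 2 (|K| -
    1)/2)/3 values. *)
Lemma card_fcubic2 : (3 * #|[set fcubic x | x : K]| <= 2 * #|K| - 1)%N.
Proof.
pose T := [set xpar s | s in [set~ 0%R]].
pose S := [set x | [exists y, fquad x y == 0]].
have TS : ~: S \subset T.
  apply/subsetP => x; rewrite !inE => nx; apply: contraNT nx => xT.
  have [s s0|y Ey] := @fquad_nonpar x; last by apply/existsP; exists y; rewrite Ey.
  by apply: contraNneq xT => ->; apply: imset_f; rewrite !inE.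
have cS : (3 * #|fcubic @: S| <= #|S|)%N.
  apply: geq_card_imset_fibers => x; rewrite inE => /existsP[y /eqP Exy].
  have [xy h1 h2] := fquad_distinct Exy.
  pose z := - (x + y).
  have Eyx : fquad y x = 0 by rewrite -Exy /fquad; ring.
  have Ezx : fquad z x = 0 by rewrite -Exy /fquad /z; ring.
  have Exz : fquad x z = 0 by rewrite -Exy /fquad /z; ring.
  have xz : x != z by apply: contraNneq h2; rewrite /z => E; rewrite mulr2n {1}E; apply/eqP; ring.
  have yz : y != z by apply: contraNneq h1; rewrite /z => E; rewrite mulr2n {2}E; apply/eqP; ring.
  apply: leq_trans (_ : 3 <= #|[set x; y; z]|)%N _.
    by rewrite cards3.
  apply: subset_leq_card; apply/subsetP => u; rewrite !inE.
  move=> /orP[/orP[]|]/eqP->; rewrite fcubic_eq ?eqxx ?andbT.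
  - by apply/existsP; exists y; rewrite Exy.
  - by rewrite Eyx eqxx orbT andbT; apply/existsP; exists x; rewrite Eyx.
  - by rewrite Ezx eqxx orbT andbT; apply/existsP; exists x; rewrite Ezx.
have cV : (#|[set fcubic x | x : K]| <= #|~: S| + #|fcubic @: S|)%N.
  have -> : [set fcubic x | x : K] = fcubic @: (~: S :|: S).
    by apply/setP => v; apply/imsetP/imsetP => -[x _ ->]; exists x; rewrite // setUC setUCr inE.
  rewrite imsetU.
  rewrite (leq_trans (leq_card_setU _ _)) // leq_add2r.
  exact: leq_imset_card.
have K0 : (0 < #|K|)%N by apply/card_gt0P; exists 0.
have arith (q s c t f v : nat) : (0 < q -> s + c = q -> 2 * t <= q.-1 -> c <= t ->
    3 * f <= s -> v <= c + f -> 3 * v <= 2 * q - 1)%N by clear; lia.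
exact: arith K0 (cardsC S) card_xpar (subset_leq_card TS) cS cV.
Qed.

Lemma exists_split2 : exists x y, [/\ fquad x y = 0, x != y,
   x + y *+ 2 != 0 & x *+ 2 + y != 0].
Proof.
pose T := [set xpar s | s in [set~ 0%R]].
have [x xT] : exists x, x \notin T.
  apply/existsP; rewrite -negb_forall; apply/negP => /forallP xT.
  have : T = setT by apply/setP => x; rewrite xT inE.
  move=> ET; have := card_xpar; rewrite -/T ET cardsT.
  have K0 : (0 < #|K|)%N by apply/card_gt0P; exists 0.
  have arith (q : nat) : (0 < q -> 2 * q <= q.-1 -> False)%N by clear; lia.
  exact: arith K0.
have [s s0|y Ey] := @fquad_nonpar x.
  by apply: contraNneq xT => ->; apply: imset_f; rewrite !inE.
by exists x, y; have [] := fquad_distinct Ey.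
Qed.

End CardTwoModThree.
End FiniteField.

(** * Fields with 1 modulo 3 elements *)

Section CardOneModThree.

Variable K : finFieldType.
Hypothesis three_neq0 : 3%:R != 0 :> K.

Lemma exists_cube_root_of_unity : (#|K| %% 3 = 1)%N -> (1 < #|K|)%N ->
  exists o : K, o ^+ 2 + o + 1 = 0.
Proof.
move=> card1 K1; have arith (q : nat) : (q %% 3 = 1 -> 1 < q ->
    [/\ 0 < q %/ 3, q %/ 3 < q.-1 & q %/ 3 * 3 = q.-1])%N by clear => ? ?; split; lia.
have [k0 kq kE] := arith _ card1 K1.
have [c c0 ck] := exists_expf_neq1 k0 kq.
have o3 : (c ^+ (#|K| %/ 3)) ^+ 3 = 1.
  rewrite -exprM kE; apply: (mulfI c0); rewrite -exprS prednK ?mulr1 ?expf_card //.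
  exact: ltnW.
exists (c ^+ (#|K| %/ 3)); move: ck o3; set o := c ^+ _ => o1 o3.
have /eqP : (o - 1) * (o ^+ 2 + o + 1) = 0.
  by rewrite (_ : _ * _ = o ^+ 3 - 1); [rewrite o3 subrr | ring].
by rewrite mulf_eq0 subr_eq0 (negPf o1) => /eqP.
Qed.

Variable o : K.
Hypothesis oE : o ^+ 2 + o + 1 = 0.
(** Not a prime here, but the other primitive cube root of unity: p = o^2 = 1/o. *)
Let p := - (1 + o).

Let op1 : o * p = 1.
Proof. by rewrite /p -[RHS]subr0 -oE; ring. Qed.

Let opN1 : o + p = -1.
Proof. by rewrite /p; ring. Qed.

Let o0 : o != 0.
Proof. by apply/eqP => E; move: oE => /eqP; rewrite E expr0n /= !add0r oner_eq0. Qed.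

Let p0 : p != 0.
Proof. by apply/eqP => E; move: op1 => /eqP; rewrite E mulr0 eq_sym oner_eq0. Qed.

Let o1 : o != 1.
Proof.
apply: contraNneq three_neq0 => E.
by rewrite -oE E expr1n; apply/eqP; ring.
Qed.

Let pp : p ^+ 2 = o.
Proof.
by rewrite -[RHS]addr0 -oE /p; ring.
Qed.

Let oo : o ^+ 2 = p.
Proof. by rewrite -[RHS]addr0 -oE /p; ring. Qed.

Let p1 : p != 1.
Proof. by apply: contraNneq o1 => E; rewrite -pp E expr1n. Qed.

Let o_neq_p : o != p.
Proof. by apply: contraNneq o1 => E; rewrite -op1 -E -expr2 oo E. Qed.

Lemma cube_eq (t c : K) : (t ^+ 3 == c ^+ 3) = [|| t == c, t == o * c | t == p * c].
Proof.
rewrite -subr_eq0 -!(subr_eq0 t) -!mulf_eq0.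
have -> : (t - c) * ((t - o * c) * (t - p * c)) =
    (t - c) * (t ^+ 2 - (o + p) * c * t + o * p * c ^+ 2) by ring.
by rewrite op1 opN1; congr (_ == 0); ring.
Qed.

Lemma card_cube_eq (c : K) : c != 0 -> #|[set t | t ^+ 3 == c ^+ 3]| = 3%N.
Proof.
move=> c0; have -> : [set t | t ^+ 3 == c ^+ 3] = [set c; o * c; p * c].
  by apply/setP => t; rewrite !inE cube_eq orbA.
rewrite cards3 //; first by rewrite -{1}[c]mul1r (inj_eq (mulIf c0)) eq_sym.
  by rewrite (inj_eq (mulIf c0)).
by rewrite -{1}[c]mul1r (inj_eq (mulIf c0)) eq_sym.
Qed.

(** The companion u of s in Cardano's formula: 3su = -1, so that [xpar s] = s + u and [hpar s] = s^3
    + u^3. *)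
Definition conj_par (s : K) := - (3%:R * s)^-1.

Lemma conj_par_neq0 s : s != 0 -> conj_par s != 0.
Proof. by move=> s0; rewrite oppr_eq0 invr_eq0 mulf_neq0. Qed.

Lemma conj_parM s : s != 0 -> 3%:R * s * conj_par s = -1.
Proof. by move=> s0; rewrite mulrN divff ?mulf_neq0. Qed.

Lemma twentyseven_neq0 : 27%:R != 0 :> K.
Proof. by rewrite (_ : 27%:R = 3%:R ^+ 3) ?expf_neq0 //; ring. Qed.

Lemma hpar_conj s : hpar s = s ^+ 3 + conj_par s ^+ 3.
Proof.
rewrite /hpar /conj_par exprNn exprVn exprMn -signr_odd /= expr1 mulN1r.
by congr (_ - (_ * _)^-1); ring.
Qed.

(** With u = [conj_par s], the product of the three linear factors is y^3 - 3suy - (s^3 + u^3), and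
    3su = -1. *)
Lemma fcubic_hpar s y : s != 0 ->
  (fcubic y == hpar s) = [|| y == s + conj_par s,
     y == o * s + p * conj_par s | y == p * s + o * conj_par s].
Proof.
move=> s0; rewrite -subr_eq0 -!(subr_eq0 y) -!mulf_eq0 hpar_conj.
set u := conj_par s.
have -> : (y - (s + u)) * ((y - (o * s + p * u)) * (y - (p * s + o * u))) =
   (y - (s + u)) * (y ^+ 2 - (o + p) * (s + u) * y + (o * p) * (s ^+ 2 + u ^+ 2)
      + ((o + p) ^+ 2 - 2%:R * (o * p)) * s * u) by ring.
rewrite op1 opN1; congr (_ == 0).
have -> : fcubic y = y ^+ 3 - 3%:R * s * u * y by rewrite conj_parM // /fcubic; ring.
ring.
Qed.

(** t^3 ([hpar t] - [hpar s]) is the resolvent, quadratic in t^3, with roots s^3 and u^3. *)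
Lemma hpar_eq s t : s != 0 -> t != 0 ->
  (hpar t == hpar s) = (t ^+ 3 == s ^+ 3) || (t ^+ 3 == conj_par s ^+ 3).
Proof.
move=> s0 t0; rewrite -subr_eq0 -(subr_eq0 (t ^+ 3)) -(subr_eq0 _ (conj_par s ^+ 3)) -mulf_eq0.
have -> : (t ^+ 3 - s ^+ 3) * (t ^+ 3 - conj_par s ^+ 3) = t ^+ 3 * (hpar t - hpar s).
  rewrite (hpar_conj s) /hpar; have E := conj_parM s0; move: (conj_par s) E => u E.
  have -> : t ^+ 3 * (t ^+ 3 - (27%:R * t ^+ 3)^-1 - (s ^+ 3 + u ^+ 3)) =
     t ^+ 3 * (t ^+ 3 - (s ^+ 3 + u ^+ 3)) + (-1) ^+ 3 / 27%:R.
    by field; rewrite twentyseven_neq0 t0.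
  by rewrite -E; field; rewrite twentyseven_neq0.
by rewrite mulf_eq0 expf_eq0 (negPf t0).
Qed.

Definition fib (v : K) := [set x : K | fcubic x == v].
Definition hfib (v : K) := [set s in [set~ 0%R] | hpar s == v].

Lemma hfib_hpar s : s != 0 ->
  hfib (hpar s) = [set t | t ^+ 3 == s ^+ 3] :|: [set t | t ^+ 3 == conj_par s ^+ 3].
Proof.
move=> s0; apply/setP => t; rewrite !inE.
have [->|t0] /= := eqVneq t 0; last by rewrite hpar_eq.
by rewrite expr0n /= ![0 == _]eq_sym !expf_eq0 /= (negPf s0) (negPf (conj_par_neq0 s0)).
Qed.

Lemma fib_hpar s : s != 0 ->
  fib (hpar s) = [set s + conj_par s; o * s + p * conj_par s; p * s + o * conj_par s].
Proof. by move=> s0; apply/setP => y; rewrite !inE fcubic_hpar // orbA. Qed.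

Lemma card_fib_simple s : s != 0 -> s ^+ 3 != conj_par s ^+ 3 ->
  #|fib (hpar s)| = 3%N /\ #|hfib (hpar s)| = 6%N.
Proof.
move=> s0 su; have u0 := conj_par_neq0 s0; split.
  rewrite fib_hpar //; move: su; rewrite cube_eq !negb_or => /and3P[su sou spu].
  rewrite cards3 // -subr_eq0.
  - rewrite (_ : _ - _ = (1 - o) * (s - p * conj_par s)); last first.
      have -> : (1 - o) * (s - p * conj_par s) =
          (1 - o) * s - p * conj_par s + (o * p) * conj_par s by ring.
      by rewrite op1; ring.
    by rewrite mulf_neq0 // subr_eq0 // eq_sym.
  - rewrite (_ : _ - _ = (o - p) * (s - conj_par s)); last by ring.
    by rewrite mulf_neq0 // subr_eq0.
  rewrite (_ : _ - _ = (1 - p) * (s - o * conj_par s)); last first.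
    have -> : (1 - p) * (s - o * conj_par s) =
        (1 - p) * s - o * conj_par s + (o * p) * conj_par s by ring.
    by rewrite op1; ring.
  by rewrite mulf_neq0 // subr_eq0 // eq_sym.
rewrite hfib_hpar // cardsU !card_cube_eq // (_ : _ :&: _ = set0) ?cards0 //.
by apply/setP => t; rewrite !inE; apply/negP => /andP[/eqP-> ]; rewrite (negPf su).
Qed.

Lemma card_fib_double s : s != 0 -> s = conj_par s ->
  #|fib (hpar s)| = 2%N /\ #|hfib (hpar s)| = 3%N.
Proof.
move=> s0 su; rewrite fib_hpar // hfib_hpar // -su setUid card_cube_eq //; split=> //.
rewrite [p * s + _]addrC -setUA setUid -mulrDl opN1 cards2 mulN1r.
by rewrite -mulr2n -addr_eq0 -mulrSr -mulr_natl mulf_neq0.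
Qed.

Lemma conj_parMl c d s : c * d = 1 -> s != 0 -> conj_par (c * s) = d * conj_par s.
Proof.
move=> cd s0; have c0 : c != 0.
  by apply: contra_eq_neq cd => ->; rewrite mul0r eq_sym oner_neq0.
apply: (mulfI (mulf_neq0 three_neq0 (mulf_neq0 c0 s0))).
rewrite conj_parM ?mulf_neq0 // -(conj_parM s0) -[LHS]mul1r -cd; ring.
Qed.

(* For a value [v], the pair (#|fib v|, #|hfib v|) is (1, 0), (3, 6) or (2, 3). *)
Lemma card_fib v :
  (3 * #|fib v| = 3 * (v \in [set fcubic x | x : K]) + #|hfib v|)%N.
Proof.
have [/eqP hv|[s]] := set_0Vmem (hfib v); last first.
  rewrite !inE => /andP[s0 /eqP <-].
  have -> : hpar s \in [set fcubic x | x : K].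
    by apply/imsetP; exists (s + conj_par s) => //; apply/esym/eqP; rewrite fcubic_hpar ?eqxx.
  have [E|su] := eqVneq (s ^+ 3) (conj_par s ^+ 3); last first.
    by have [-> ->] := card_fib_simple s0 su.
  (* When s^3 = u^3, multiplying s by a cube root of unity keeps the value and can make the
     parameter its own companion. *)
  have [t [t0 th tu]] : exists t, [/\ t != 0, hpar t = hpar s & t = conj_par t].
    have po1 : p * o = 1 by rewrite mulrC.
    have cub c : c ^+ 3 = 1 -> c * s != 0 -> hpar (c * s) = hpar s.
      by move=> c3 cs; apply/eqP; rewrite hpar_eq // exprMn c3 mul1r eqxx.
    have o3 : o ^+ 3 = 1 by rewrite exprS oo op1.
    have p3 : p ^+ 3 = 1 by rewrite exprS pp po1.
    move: E => /eqP; rewrite cube_eq => /or3P[]/eqP E.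
    - by exists s.
    - exists (o * s); split; rewrite ?mulf_neq0 ?cub ?mulf_neq0 //.
      by rewrite (conj_parMl op1) // {1}E mulrA -expr2 oo.
    exists (p * s); split; rewrite ?mulf_neq0 ?cub ?mulf_neq0 //.
    by rewrite (conj_parMl po1) // {1}E mulrA -expr2 pp.
  by rewrite -th; have [-> ->] := card_fib_double t0 tu.
rewrite (eqP hv) cards0 addn0; congr (_ * _)%N.
have [/imsetP[x _ vx]|nv] := boolP (v \in _); last first.
  apply/eqP; rewrite cards_eq0; apply/eqP/setP => x; rewrite !inE.
  by apply: contraNF nv => /eqP <-; apply: imset_f.
rewrite (_ : fib v = [set x]) ?cards1 //; apply/setP => y; rewrite !inE vx fcubic_eq.
have [//|yx] /= := eqVneq y x; apply/negP => /eqP Q.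
have od : o - p != 0 by rewrite subr_eq0.
have od2 : (o - p) ^+ 2 = - 3%:R.
  have -> : (o - p) ^+ 2 = (o + p) ^+ 2 - 4%:R * (o * p) by ring.
  by rewrite opN1 op1; ring.
(* A second preimage y would yield a parameter: s and t solve s + t = x, o s + p t = y. *)
pose s := (y - p * x) / (o - p); pose t := (o * x - y) / (o - p).
have st : 3%:R * s * t = -1.
  have -> : 3%:R * s * t = 3%:R * ((y - p * x) * (o * x - y)) / (o - p) ^+ 2.
    by rewrite /s /t -exprVn; ring.
  have -> : (y - p * x) * (o * x - y) = (o + p) * x * y - (o * p) * x ^+ 2 - y ^+ 2 by ring.
  rewrite opN1 op1 od2 (_ : _ - y ^+ 2 = 1 - fquad y x); last by rewrite /fquad; ring.
  by rewrite Q subr0 mulr1 invrN mulrN divff.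
have s0 : s != 0.
  by apply/eqP => s0; move: st => /eqP; rewrite s0 mulr0 mul0r eq_sym oppr_eq0 oner_eq0.
have tE : t = conj_par s.
  by apply: (mulfI (mulf_neq0 three_neq0 s0)); rewrite st conj_parM.
have : s \in hfib v.
  rewrite !inE s0 /= eq_sym vx fcubic_hpar // -tE (_ : x == s + t) //.
  rewrite /s /t -mulrDl (_ : _ + _ = x * (o - p)); last by ring.
  by rewrite mulfK.
by rewrite (eqP hv) inE.
Qed.

(** The relation of [card_fib], weighted by phi(v) and summed over v: a sum over the values is
    traded for sums over K and over its nonzero elements. *)
Lemma sum_image_fcubic (M : nmodType) (phi : K -> M) :
  (\sum_(v in [set fcubic x | x : K]) phi v) *+ 3 + \sum_(s in [set~ 0%R]) phi (hpar s) =
  (\sum_x phi (fcubic x)) *+ 3.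
Proof.
have fibsum (g : K -> K) (D : {set K}) :
    \sum_(x in D) phi (g x) = \sum_v phi v *+ #|[set x in D | g x == v]|.
  rewrite (partition_big g predT) //=; apply: eq_bigr => v _.
  rewrite -sumr_const; apply: congr_big => //.
    by move=> x; rewrite inE.
  by move=> x /andP[_ /eqP->].
have -> : \sum_x phi (fcubic x) = \sum_(x in [set: K]) phi (fcubic x).
  by apply: eq_bigl => x; rewrite inE.
rewrite (fibsum (@fcubic K)) (fibsum (@hpar K)) big_mkcond /= -!sumrMnl -big_split /=.
apply: eq_bigr => v _.
have -> : phi v *+ #|[set x in [set: K] | fcubic x == v]| *+ 3 = phi v *+ (3 * #|fib v|).
  rewrite -mulrnA mulnC; congr (_ *+ (_ * _)).
  by apply: eq_card => x; rewrite !inE.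
rewrite card_fib mulrnDr; congr (_ + _).
by case: (v \in _); rewrite ?muln1 ?muln0 ?mulr0n ?mul0rn.
Qed.

Lemma card_image_fcubic1 : (3 * #|[set fcubic x | x : K]| = 2 * #|K| + 1)%N.
Proof.
have := sum_image_fcubic (fun _ => 1%N).
rewrite !sum1_card cardsC1.
have K0 : (0 < #|K|)%N by apply/card_gt0P; exists 0.
have arith (q v : nat) : (0 < q -> v *+ 3 + q.-1 = q *+ 3 -> 3 * v = 2 * q + 1)%N.
  by clear; rewrite !mulrS !mulr0n /GRing.add /=; lia.
exact: arith K0.
Qed.

(** Take phi(v) = v^2. The power sums up to exponent 6 vanish; from the square of [hpar s] only the
    constant -2/27 survives, summed |K| - 1 = -1 times. *)
Lemma sum_sqr_image_fcubic : (7 < #|K|)%N ->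
  81%:R * (\sum_(v in [set fcubic x | x : K]) v ^+ 2) = - 2%:R.
Proof.
move=> K7; have pw k : (0 < k)%N -> (k <= 6)%N -> \sum_(x : K) x ^+ k = 0.
  by move=> k0 k6; apply: sum_expf => //; apply: leq_ltn_trans k6 _; rewrite -ltnS prednK // (leq_trans _ K7).
have E := sum_image_fcubic (fun v => v ^+ 2).
have Sf : \sum_(x : K) fcubic x ^+ 2 = 0.
  rewrite (eq_bigr (fun x => x ^+ 6 + (x ^+ 4 + x ^+ 4) + x ^+ 2)).
    by rewrite !big_split /= !pw // !addr0.
  by move=> x _; rewrite /fcubic; ring.
have p6 : \sum_(s in [set~ 0%R]) s ^+ 6 = 0 :> K.
  rewrite -[RHS](pw 6) // [RHS](bigD1 0) //= expr0n add0r.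
  by apply: eq_bigl => x; rewrite !inE.
have pV : \sum_(s in [set~ 0%R]) (s^-1) ^+ 6 = 0 :> K.
  rewrite -[RHS]p6 [RHS](reindex_inj invr_inj) /=; apply: eq_bigl => x.
  by rewrite !inE invr_eq0.
have predE : #|K|.-1%:R = -1 :> K.
  by rewrite -subn1 natrB ?natf_card0 ?sub0r // (leq_trans _ K7).
have Sh : 27%:R * \sum_(s in [set~ 0%R]) hpar s ^+ 2 = 2%:R :> K.
  rewrite mulr_sumr (eq_bigr (fun s : K => 27%:R * s ^+ 6 - 2%:R + 27%:R^-1 * (s^-1) ^+ 6)).
    rewrite !big_split /= -!mulr_sumr p6 pV !mulr0 add0r addr0 sumr_const cardsC1.
    by rewrite -[LHS]mulr_natr predE mulrN1 opprK.
  move=> s; rewrite !inE => s0; rewrite /hpar; field.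
  by rewrite s0 twentyseven_neq0.
move: E; rewrite Sf mul0rn => /eqP; rewrite addr_eq0 => /eqP E.
have -> : 81%:R = 27%:R * 3%:R :> K by ring.
by rewrite -mulrA [3%:R * _]mulr_natl E mulrN Sh.
Qed.

(** A parameter with s^3 = u^3 satisfies 27 s^6 = -1. If 1 does, then 27 = -1, and any c with c^6
    different from 1 does not. A parameter that does not has three distinct roots. *)
Lemma exists_split1 : (7 < #|K|)%N -> exists x y : K, [/\ fquad x y = 0, x != y,
   x + y *+ 2 != 0 & x *+ 2 + y != 0].
Proof.
move=> K7.
have [s s0 su] : exists2 s : K, s != 0 & s ^+ 3 != conj_par s ^+ 3.
  have [c c0 c6] : exists2 c : K, c != 0 & c ^+ 6 != 1.
    by apply: exists_expf_neq1 => //; rewrite -ltnS prednK // (leq_trans _ K7).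
  have bad s : s != 0 -> s ^+ 3 = conj_par s ^+ 3 -> 27%:R * s ^+ 6 = -1.
    move=> s0 E; have -> : 27%:R * s ^+ 6 = 27%:R * (s ^+ 3 * s ^+ 3) by ring.
    rewrite {2}E (_ : 27%:R * _ = (3%:R * s * conj_par s) ^+ 3); last by ring.
    by rewrite conj_parM //; ring.
  have [E1|] := eqVneq (1 ^+ 3) (conj_par 1 ^+ 3); last by exists 1; rewrite ?oner_neq0.
  have := bad 1 (oner_neq0 _) E1; rewrite expr1n mulr1 => N27.
  exists c => //; apply: contraNneq c6 => /(bad c c0); rewrite N27 mulN1r.
  by move=> /oppr_inj ->.
have [c3 _] := card_fib_simple s0 su; rewrite fib_hpar // in c3.
set x := s + _ in c3; set y := o * s + _ in c3; set z := p * s + _ in c3.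
have xyz : x + y + z = 0.
  have -> : x + y + z = (1 + (o + p)) * (s + conj_par s) by rewrite /x /y /z; ring.
  by rewrite opN1 addrN mul0r.
have [xy yz xz] : [/\ x != y, y != z & x != z].
  split; apply/eqP => E; move: c3; rewrite E.
  - by rewrite setUid => c2; have := cards2 y z; rewrite c2; case: (_ != _).
  - by rewrite -setUA setUid => c2; have := cards2 x z; rewrite c2; case: (_ != _).
  - by rewrite setUAC setUid => c2; have := cards2 z y; rewrite c2; case: (_ != _).
have zE : z = - (x + y) by apply/eqP; rewrite -addr_eq0 addrC xyz.
exists x, y; split=> //.
- have : fcubic x == fcubic y.
    have /eqP-> : fcubic x == hpar s by rewrite fcubic_hpar // eqxx.
    by rewrite eq_sym fcubic_hpar // eqxx orbT.
  by rewrite fcubic_eq (negPf xy) => /eqP.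
- apply: contraNneq yz => E; rewrite -subr_eq0 zE -E; apply/eqP; ring.
- apply: contraNneq xz => E; rewrite -subr_eq0 zE -E; apply/eqP; ring.
Qed.

(** o - p is a square root of -3. The r obtained is a double root: Q(r, r) = 0. *)
Lemma sqr_m3 : exists r : K, 3%:R * r ^+ 2 + 1 = 0.
Proof.
exists ((o - p)^-1).
have od : o - p != 0 by rewrite subr_eq0.
have od2 : (o - p) ^+ 2 = - 3%:R.
  have -> : (o - p) ^+ 2 = (o + p) ^+ 2 - 4%:R * (o * p) by ring.
  by rewrite opN1 op1; ring.
by rewrite exprVn od2 invrN mulrN divff // addNr.
Qed.

End CardOneModThree.

(** * Prime and prime power moduli *)

Section PrimeField.

Variable p : nat.
Hypotheses (p_prime : prime p) (p_ge5 : (5 <= p)%N).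

Let charFp : p \in [pchar 'F_p].
Proof. exact: pchar_Fp. Qed.

Lemma Fp_natr_eq0 n : (n%:R == 0 :> 'F_p) = (p %| n)%N.
Proof. by rewrite (dvdn_pcharf charFp). Qed.

Lemma Fp_natr_eq a b : (a%:R == b%:R :> 'F_p) = (a == b %[mod p]).
Proof.
wlog ab : a b / (a <= b)%N.
  by move=> H; case: (leqP a b) => [/H //|/ltnW/H]; rewrite eq_sym => ->; rewrite eq_sym.
by rewrite [RHS]eq_sym eqn_mod_dvd // -Fp_natr_eq0 natrB // subr_eq0 eq_sym.
Qed.

Lemma Fp_natr_small k : (0 < k < 5)%N -> k%:R != 0 :> 'F_p.
Proof.
move=> /andP[k0 k5]; rewrite Fp_natr_eq0 gtnNdvd //.
exact: leq_trans p_ge5.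
Qed.

Lemma Fp_two_neq0 : 2%:R != 0 :> 'F_p. Proof. exact: Fp_natr_small. Qed.
Lemma Fp_three_neq0 : 3%:R != 0 :> 'F_p. Proof. exact: Fp_natr_small. Qed.

Lemma natr_cubic a : (cubic a)%:R = fcubic (a%:R : 'F_p).
Proof. by rewrite /cubic /fcubic natrD natrX. Qed.

Lemma natr_quad a b : (quad a b)%:R = fquad (a%:R : 'F_p) b%:R.
Proof. by rewrite /quad /fquad !natrD natrM !natrX. Qed.

Let cardFp : #|'F_p| = p. Proof. exact: card_Fp. Qed.

Let p_mod3 : (p %% 3 = 1 \/ p %% 3 = 2)%N.
Proof.
have := ltn_pmod p (isT : (0 < 3)%N).
case E : (p %% 3)%N => [|[|[|]]] // _; [|by left|by right].
have : (3 %| p)%N by rewrite /dvdn E.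
by rewrite dvdn_prime2 // => /eqP p3; move: p_ge5; rewrite -p3.
Qed.

Lemma split_mod_prime : p != 7 -> split_mod p.
Proof.
move=> p7.
have [x [y [Q xy h1 h2]]] : exists x y : 'F_p, [/\ fquad x y = 0, x != y,
    x + y *+ 2 != 0 & x *+ 2 + y != 0].
  have [r|r] := p_mod3; last first.
    by apply: exists_split2; rewrite ?Fp_two_neq0 ?Fp_three_neq0 ?cardFp.
  have [o oE] : exists o : 'F_p, o ^+ 2 + o + 1 = 0.
    apply: exists_cube_root_of_unity; rewrite ?cardFp ?Fp_three_neq0 //.
    exact: leq_trans p_ge5.
  apply: (exists_split1 Fp_three_neq0 oE); rewrite cardFp ltn_neqAle eq_sym p7 /=.
  by case: (p) p_ge5 r => [|[|[|[|[|[|[|]]]]]]].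
exists (x : nat), (y : nat); split.
- by rewrite -Fp_natr_eq0 natr_quad !natr_Zp Q.
- by rewrite -Fp_natr_eq !natr_Zp.
- by rewrite -Fp_natr_eq0 natrD -muln2 natrM !natr_Zp mulr_natr.
- by rewrite -Fp_natr_eq0 natrD -muln2 natrM !natr_Zp mulr_natr.
Qed.

Lemma nvals_Fp : (nvals p <= #|[set fcubic x | x : 'F_p]|)%N.
Proof.
have us : uniq [seq v%:R : 'F_p | v <- vals p].
  rewrite map_inj_in_uniq ?undup_uniq // => v w /valsP[a _ ->] /valsP[b _ ->] /eqP.
  by rewrite Fp_natr_eq !modn_mod => /eqP.
rewrite /nvals -(size_map (fun v => v%:R : 'F_p)) -(card_uniqP us).
apply: subset_leq_card; apply/subsetP => x /mapP[v /valsP[a _ ->] ->].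
apply/imsetP; exists (a%:R) => //; rewrite -natr_cubic.
by apply/eqP; rewrite Fp_natr_eq modn_mod.
Qed.

Lemma nvals_prime2 : (p %% 3 = 2 -> 3 * nvals p <= 2 * p - 1)%N.
Proof.
move=> r; apply: leq_trans (_ : 3 * #|[set fcubic x | x : 'F_p]| <= _)%N.
  by rewrite leq_mul2l nvals_Fp.
rewrite -[in X in (_ <= X)%N]cardFp.
by apply: card_fcubic2; rewrite ?Fp_two_neq0 ?Fp_three_neq0 ?cardFp.
Qed.

Lemma Fp_cube_root : (p %% 3 = 1)%N -> exists o : 'F_p, o ^+ 2 + o + 1 = 0.
Proof.
move=> r; apply: exists_cube_root_of_unity; rewrite ?cardFp ?Fp_three_neq0 //.
exact: leq_trans p_ge5.
Qed.

Lemma nvals_prime1 : (p %% 3 = 1 -> 3 * nvals p <= 2 * p + 1)%N.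
Proof.
move=> /Fp_cube_root[o oE].
rewrite -[in X in (_ <= X)%N]cardFp -(card_image_fcubic1 Fp_three_neq0 oE).
by rewrite leq_mul2l nvals_Fp.
Qed.

Lemma dvdn_three_sqr_add1 a : (p %% 3 = 2)%N -> ~~ (p %| 3 * a ^ 2 + 1)%N.
Proof.
move=> r; rewrite -Fp_natr_eq0 natrD natrM natrX.
by apply: three_sqr_add1_neq0; rewrite ?Fp_two_neq0 ?Fp_three_neq0 ?cardFp.
Qed.

Lemma dvdn_three_sqr_add4 a : (p %% 3 = 2)%N -> ~~ (p %| 3 * a ^ 2 + 4)%N.
Proof.
move=> r; rewrite -Fp_natr_eq0 natrD natrM natrX.
have -> : 3%:R * a%:R ^+ 2 + 4%:R = 4%:R * (3%:R * (a%:R / 2%:R) ^+ 2 + 1) :> 'F_p.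
  by field; rewrite Fp_two_neq0.
rewrite mulf_neq0 ?Fp_natr_small //.
by apply: three_sqr_add1_neq0; rewrite ?Fp_two_neq0 ?Fp_three_neq0 ?cardFp.
Qed.

(** For a double root r, p divides Q(r, r + e p), while the difference is e p. The bound r + e p <=
    n follows from p >= 7: both p and e p are at most m/7. *)
Lemma collides_sqr_dvd n m : (p %% 3 = 1)%N -> (0 < m)%N -> (p ^ 2 %| m)%N ->
  (m < 3 * n)%N -> collides n m.
Proof.
move=> r3 m0 /dvdnP[e mE] mn.
have [o oE] := Fp_cube_root r3.
have [r rE] := sqr_m3 Fp_three_neq0 oE.
have r0 : r != 0.
  by apply/eqP => r0; move: rE => /eqP; rewrite r0 expr0n /= mulr0 add0r oner_eq0.
have e0 : (0 < e)%N by case: (e) mE m0 => // ->.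
have rp : (r < p)%N by have := ltn_ord r; rewrite [X in (_ < X)%N]Fp_cast.
have h : (0 < e * p)%N by rewrite muln_gt0 e0 prime_gt0.
have p7 : (7 <= p)%N.
  by case: (p) p_ge5 r3 => [|[|[|[|[|[|[|q]]]]]]].
have mE2 : m = (e * p * p)%N by rewrite mE expnS expn1 mulnA.
exists (r : nat), (r + e * p)%N; split.
- by rewrite lt0n -(inj_eq val_inj) in r0 *.
- by rewrite -[X in (X < _)%N]addn0 ltn_add2l.
- have : (p * p <= e * p * p)%N by rewrite leq_pmul2r ?prime_gt0 // leq_pmull.
  have : (7 * (e * p) <= e * p * p)%N by rewrite mulnC leq_pmul2l.
  have : (7 * p <= p * p)%N by rewrite leq_pmul2r ?prime_gt0.
  by move: mn; rewrite mE2; move: (e * p * p)%N (p * p)%N (e * p)%N rp; clear; lia.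
rewrite addKn mE2 dvdn_mul // -Fp_natr_eq0 natr_quad natrD natrM.
by rewrite (pcharf0 charFp) mulr0 addr0 natr_Zp /fquad -rE; apply/eqP; ring.
Qed.

End PrimeField.

(** * Extending injectivity from [1, n] to [-n, n] *)

Local Open Scope nat_scope.

Lemma collidesPn n m a b : ~ collides n m -> 0 < a <= n -> 0 < b <= n ->
  cubic a = cubic b %[mod m] -> a = b.
Proof.
move=> nc /andP[a0 an] /andP[b0 bn] E; apply/eqP/negPn/negP => ab; apply: nc.
exact: collides_cubic ab E.
Qed.

(** With P - b standing for -b, the roots are a, -b and b - a. The two of equal sign are, up to
    sign, min(a,b) and |a - b|, which is the sum of the two truncated differences. *)
Lemma quad_reflect P a b : b <= P -> P %| quad a (P - b) ->
  P %| quad (minn a b) (a - b + (b - a)).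
Proof.
move=> /subnKC; move: (P - b) => e PE q.
suff E : quad (minn a b) (a - b + (b - a)) + (a + P) * P = quad a e + 2 * b * P.
  have : P %| quad a e + 2 * b * P by rewrite dvdn_add // dvdn_mull.
  by rewrite -E dvdn_addl // dvdn_mull.
case: (leqP a b) => [ab|/ltnW ab]; rewrite (eqP ab) ?addn0 ?add0n -PE.
  by rewrite -{2 3 4 5}(subnKC ab); move: (b - a) => d; rewrite /quad; ring.
by rewrite -{2 3}(subnKC ab); move: (a - b) => d; rewrite /quad; ring.
Qed.

Lemma dvdn_cubic_opp P b : b <= P -> P %| cubic (P - b) + cubic b.
Proof.
move=> /subnKC; move: (P - b) => e <-.
rewrite -(dvdn_addl _ (dvdn_mulr (e * b) (dvdnn (b + e)))).
have -> : cubic e + cubic b + (b + e) * (e * b) = (b + e) * (b ^ 2 + e ^ 2 + 1).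
  by rewrite /cubic; ring.
exact: dvdn_mulr.
Qed.

(* If [-b] has the same value as some [a] in [1, n], then so has the third root
   [b - a], and up to sign it lies in [0, n]; this forces a collision in [1, n]
   unless the three roots are [0, b, -b], or two of them coincide. *)
Definition exceptional P b :=
  [|| P %| b ^ 2 + 1, P %| 3 * b ^ 2 + 1 | P %| 3 * b ^ 2 + 4].

Definition signed_reps P n :=
  iota 1 n ++ [seq P - b | b <- iota 1 n & ~~ exceptional P b].

Lemma uniq_signed_reps P n : 2 * n < P -> ~ collides n P ->
  (forall a b, 0 < a <= n -> 0 < b <= n -> cubic a = cubic (P - b) %[mod P] ->
     P %| quad a (P - b)) ->
  uniq [seq cubic a %% P | a <- signed_reps P n].
Proof.
move=> nP nc H.
have inI b : b \in iota 1 n -> 0 < b <= n by rewrite mem_iota add1n ltnS.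
have leP b : b \in iota 1 n -> b <= P by move=> /inI; clear -nP; lia.
rewrite map_cat cat_uniq; apply/and3P; split.
- rewrite map_inj_in_uniq ?iota_uniq // => a b /inI aI /inI bI.
  exact: (collidesPn nc aI bI).
- apply/hasPn => v /mapP[c /mapP[b]]; rewrite mem_filter => /andP[nb bI] -> ->.
  apply: contraNN nb => /mapP[a aI] /esym E.
  have := quad_reflect (leP _ bI) (H _ _ (inI _ aI) (inI _ bI) E).
  have bn := inI _ bI; have an := inI _ aI.
  (* Injectivity on [1, n], applied to the third root b - a, leaves three cases: b = 2a, where 4
     Q(a,a) = 3b^2 + 4; a = 2b, where Q(b,b) = 3b^2 + 1; and a = b, where Q(b,0) = b^2 + 1. *)
  have [ab|ba|<-] := ltngtP a b.
  + rewrite (eqP (ltnW ab)) add0n => q.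
    have ba : b - a = a.
      by apply/esym; apply: collidesPn nc an _ (quad_cubic q); clear -bn ab; lia.
    apply/or3P/Or33; move: q; rewrite ba => q.
    have -> : 3 * b ^ 2 + 4 = 4 * quad a a.
      by rewrite -(subnKC (ltnW ab)) ba /quad; ring.
    by rewrite dvdn_mull.
  + rewrite (eqP (ltnW ba)) addn0 => q.
    have ab : a - b = b.
      by apply/esym; apply: collidesPn nc bn _ (quad_cubic q); clear -an ba; lia.
    apply/or3P/Or32; move: q; rewrite ab => q.
    by rewrite (_ : 3 * b ^ 2 + 1 = quad b b) // /quad; ring.
  + rewrite subnn addn0 /quad muln0 exp0n // !addn0 => q.
    by apply/or3P/Or31.
rewrite -map_comp map_inj_in_uniq; first by rewrite filter_uniq ?iota_uniq.
move=> a b; rewrite !mem_filter => /andP[_ aI] /andP[_ bI] /= E.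
apply: (collidesPn nc (inI _ aI) (inI _ bI)); apply/eqP.
rewrite -(eqn_modDl (cubic (P - a))) -[in X in _ == X](modnDml (cubic (P - a))) E modnDml.
have /eqP-> := dvdn_cubic_opp (leP _ aI).
by have /eqP-> := dvdn_cubic_opp (leP _ bI).
Qed.

Lemma size_signed_reps P n :
  size (signed_reps P n) + count (exceptional P) (iota 1 n) = 2 * n.
Proof.
rewrite size_cat size_map size_filter size_iota -addnA [count _ _ + _]addnC.
have := count_predC (exceptional P) (iota 1 n); rewrite size_iota => E.
by rewrite [X in n + X]E mul2n addnn.
Qed.

Lemma leq_size_signed_reps P n : 0 < P ->
  uniq [seq cubic a %% P | a <- signed_reps P n] ->
  size (signed_reps P n) <= nvals P.
Proof.
move=> P0 us; rewrite -(size_map (fun a => cubic a %% P)); apply: uniq_leq_size us _.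
by move=> x /mapP[a _ ->]; apply: mem_vals.
Qed.

Lemma count_le1 (q : pred nat) (s : seq nat) : uniq s ->
  {in s &, forall a b, q a -> q b -> a = b} -> count q s <= 1.
Proof.
move=> us H; rewrite -size_filter.
have : uniq (filter q s) by rewrite filter_uniq.
have : {in filter q s &, forall a b, a = b}.
  by move=> a b; rewrite !mem_filter => /andP[qa sa] /andP[qb sb]; apply: H.
case: (filter q s) => [|a [|b t]] // E; rewrite /= inE.
by rewrite (E a b) ?inE ?eqxx ?orbT.
Qed.

(** Each such b has value 0 modulo P. *)
Lemma count_sqr_add1 P n : ~ collides n P -> count (fun b => P %| b ^ 2 + 1) (iota 1 n) <= 1.
Proof.
move=> nc; apply: count_le1; first exact: iota_uniq.
move=> a b; rewrite !mem_iota !add1n !ltnS => aI bI qa qb.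
have z c : P %| c ^ 2 + 1 -> cubic c %% P = 0.
  move=> q; apply/eqP; have -> : cubic c = c * (c ^ 2 + 1) by rewrite /cubic; ring.
  by apply: dvdn_mull.
by apply: collidesPn nc aI bI _; rewrite !z.
Qed.

(** For p = 2 modulo 3 only b^2 + 1 can vanish, at most once. So [signed_reps P k] has at least 2k -
    1 >= (2P + 5)/3 elements, against at most (2P - P/p)/3 values modulo P. *)
Lemma collides_prime_power2 p i n : prime p -> 5 <= p -> p %% 3 = 2 ->
  p ^ i.+1 + 4 <= 3 * n -> collides n (p ^ i.+1).
Proof.
move=> pp p5 r; set P := p ^ i.+1 => nP.
have pP : p %| P by rewrite /P expnS dvdn_mulr.
have P0 : 0 < P by rewrite expn_gt0 prime_gt0.
(* For P = 5 the k chosen below would be 3, and 2k < P would fail. *)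
have [P5|P5] := eqVneq P 5.
  by exists 2, 3; rewrite P5; split=> //; clear -nP P5; lia.
have P11 : 11 <= P.
  have : p != 8 by apply: contraTneq pp => ->.
  move: P5 p5 r; rewrite /P; case: (i) => [|i']; first by rewrite expn1; clear; lia.
  move=> _ p5 _ _; apply: leq_trans (_ : 5 ^ 2 <= _) => //.
  by apply: leq_trans (_ : 5 ^ i'.+2 <= _); rewrite ?leq_exp2r ?leq_exp2l.
have P3 : P %% 3 != 0.
  by rewrite -/(dvdn 3 P) Euclid_dvdX // /dvdn r.
pose k := (P + 5) %/ 3.
apply: (@collidesW k); first by rewrite /k; clear -nP P3; lia.
case: (boolP (distinct_mod k P)) => [D|/distinct_modPn //].
have nc : ~ collides k P by move=> /distinct_modPn; rewrite D.
have kP : 2 * k < P by rewrite /k; clear -P11; lia.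
have k3 : P + 4 <= 3 * k by rewrite /k; clear -P3; lia.
have us : uniq [seq cubic a %% P | a <- signed_reps P k].
  apply: uniq_signed_reps => // a b aI bI /eqP.
  have ab : a <= P - b by move: aI bI; clear -kP; lia.
  rewrite cubic_eqmod // => dv.
  (* p cannot divide both factors, for then it would divide Q(a,a) = 3a^2 + 1. So P divides one of
     them, and P - b - a is positive and less than P. *)
  have [pD|] := boolP (p %| P - b - a); last first.
    rewrite -prime_coprime // => cop.
    by move: dv; rewrite Gauss_dvdr // /P coprimeXl.
  have [pq|] := boolP (p %| quad a (P - b)); last first.
    rewrite -prime_coprime // => cop.
    move: dv; rewrite Gauss_dvdl /P ?coprimeXl // => /dvdn_leq.
    by rewrite subn_gt0; move: aI bI; rewrite -/P; clear -kP; lia.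
  have /negP[] := dvdn_three_sqr_add1 pp p5 a r.
  have -> : 3 * a ^ 2 + 1 = quad a a by rewrite /quad; ring.
  rewrite /dvdn (@quad_eqmod p a a a (P - b)) //.
  by apply/eqP; rewrite eq_sym eqn_mod_dvd.
have := leq_size_signed_reps P0 us.
have := size_signed_reps P k.
have : count (exceptional P) (iota 1 k) <= 1.
  apply: leq_trans (count_sqr_add1 nc).
  apply: sub_count => b /or3P[//|/(dvdn_trans pP)|/(dvdn_trans pP)].
    by rewrite (negPf (dvdn_three_sqr_add1 pp p5 b r)).
  by rewrite (negPf (dvdn_three_sqr_add4 pp p5 b r)).
have := nvals_dvd P0 pP.
have := nvals_prime2 pp p5 r.
have : P %/ p * p = P by rewrite divnK.
have : 0 < P %/ p by rewrite divn_gt0 ?prime_gt0 // dvdn_leq.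
move: (P %/ p) (nvals p) (nvals P) (size _) (count _ _) => e v V S C e0 eP v3 VE C1 SC SV.
have : 3 * (e * v) <= 2 * (e * p) - e.
  by rewrite mulnCA [2 * _]mulnCA -{3}[e]muln1 -mulnBr leq_mul2l v3 orbT.
move: VE; rewrite eP; move: (e * v) => ev; clear -C1 SC SV k3 e0; lia.
Qed.

(** * Primes congruent to 1 modulo 3, where the counts can be equal *)

Section TightPrime.

Variable p : nat.
Hypotheses (p_prime : prime p) (p_mod3 : p %% 3 = 1) (p_gt7 : 7 < p).

Let p5 : 5 <= p. Proof. by apply: leq_trans p_gt7. Qed.

Let charp0 : p%:R = 0%R :> 'F_p.
Proof. by apply: pcharf0; apply: pchar_Fp. Qed.

Lemma Fp_natr_quadratic c b d :
  ((c * b ^ 2 + d)%:R = c%:R * b%:R ^+ 2 + d%:R :> 'F_p)%R.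
Proof. by rewrite natrD natrM natrX. Qed.

Lemma sqr_inj_half n a b : 2 * n < p -> 0 < a <= n -> 0 < b <= n ->
  (a%:R ^+ 2 = b%:R ^+ 2 :> 'F_p)%R -> a = b.
Proof.
move=> np aI bI /eqP; rewrite eqf_sqr => /orP[].
  by rewrite Fp_natr_eq // !modn_small => [/eqP //||]; move: aI bI; clear -np; lia.
rewrite -addr_eq0 -natrD Fp_natr_eq0 // => /dvdn_leq.
by move: aI bI; clear -np; lia.
Qed.

Local Open Scope ring_scope.

(** Faulhaber's formulas for the exponents 2, 4 and 6, over the common denominator 210. *)
Lemma sum_sqr_fcubic (R : comNzRingType) k :
  210%:R * (\sum_(1 <= i < k.+1) (i%:R ^+ 3 + i%:R) ^+ 2) =
  k%:R * (k%:R + 1) * (2%:R * k%:R + 1) *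
    (35%:R + 14%:R * (3%:R * k%:R ^+ 2 + 3%:R * k%:R - 1)
     + 5%:R * (3%:R * k%:R ^+ 4 + 6%:R * k%:R ^+ 3 - 3%:R * k%:R + 1)) :> R.
Proof.
elim: k => [|k IH]; first by rewrite big_geq // mulr0 !mul0r.
by rewrite big_nat_recr //= mulrDr IH -natr1; ring.
Qed.

(** With y = 3x^2, 27 f(x)^2 = y (y + 3)^2, which is 0, -4, -4 at y = -3, -1, -4. *)
Lemma sqr_values_exceptional (x : 'F_p) :
  27%:R * (if [|| x ^+ 2 + 1 == 0, 3%:R * x ^+ 2 + 1 == 0 | 3%:R * x ^+ 2 + 4%:R == 0]
           then fcubic x ^+ 2 else 0) =
  (if 3%:R * x ^+ 2 + 1 == 0 then - 4%:R else 0)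
  + (if 3%:R * x ^+ 2 + 4%:R == 0 then - 4%:R else 0).
Proof.
have n2 := Fp_two_neq0 p_prime p5; have n3 := Fp_three_neq0 p_prime p5.
have fE : 27%:R * fcubic x ^+ 2 = 3%:R * x ^+ 2 * (3%:R * x ^+ 2 + 3%:R) ^+ 2.
  by rewrite /fcubic; ring.
have E0 : x ^+ 2 + 1 = 0 -> 3%:R * x ^+ 2 = - 3%:R.
  by move=> /eqP; rewrite addr_eq0 => /eqP->; rewrite mulrN1.
have [/E0 E|x0] /= := eqVneq (x ^+ 2 + 1) 0.
  rewrite fE E addNr expr0n /= mulr0.
  rewrite ifN; last by rewrite (_ : _ + 1 = - 2%:R) ?oppr_eq0 //; ring.
  by rewrite ifN ?addr0 // (_ : _ + 4%:R = 1) ?oner_eq0 //; ring.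
have [/eqP|x1] /= := eqVneq (3%:R * x ^+ 2 + 1) 0.
  rewrite addr_eq0 => /eqP E; rewrite fE E ifN.
    by rewrite addr0; ring.
  by rewrite (_ : _ + 4%:R = 3%:R) //; ring.
have [/eqP|x2] /= := eqVneq (3%:R * x ^+ 2 + 4%:R) 0; last by rewrite mulr0 addr0.
by rewrite addr_eq0 => /eqP E; rewrite fE E add0r; ring.
Qed.

Lemma sum_const_count (R : nmodType) (c : R) (q : pred nat) s :
  \sum_(b <- s | q b) c = c *+ count q s.
Proof. by rewrite big_const_seq iter_addr_0. Qed.

Local Open Scope nat_scope.

(* Counting only excludes the absence of a collision up to the case k = (p + 5)/3
   where all three exceptional roots occur and [signed_reps] hits every value
   once. Then the sum of the squares of the values, computed both from k = 5/3
   in F_p and from [sum_sqr_image_fcubic], forces p to divide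
   210 * 13^2 * 17 * 31. *)
Lemma collides_prime1 n : p != 13 -> p != 31 -> p + 4 <= 3 * n -> collides n p.
Proof.
move=> p13 p31 np.
pose k := (p + 5) %/ 3.
have k3 : 3 * k = p + 5 by rewrite /k; clear -p_mod3; lia.
have p10 : p != 10 by apply: contraTneq p_prime => ->.
have kp : 2 * k < p by clear -k3 p_gt7 p_mod3 p10; lia.
apply: (@collidesW k); first by clear -k3 np p_mod3; lia.
case: (boolP (distinct_mod k p)) => [D|/distinct_modPn //].
have nc : ~ collides k p by move=> /distinct_modPn; rewrite D.
have us : uniq [seq cubic a %% p | a <- signed_reps p k].
  apply: uniq_signed_reps => // a b aI bI /eqP.
  have ab : a <= p - b by move: aI bI; clear -kp; lia.
  rewrite cubic_eqmod // Euclid_dvdM // => /orP[/dvdn_leq|//].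
  by rewrite subn_gt0; move: aI bI; clear -kp; lia.
pose q1 b := p %| 3 * b ^ 2 + 1; pose q2 b := p %| 3 * b ^ 2 + 4.
pose I := iota 1 k.
have q_le1 c d : (0 < c < 5) -> count (fun b => p %| c * b ^ 2 + d) I <= 1.
  move=> c5; apply: count_le1; first exact: iota_uniq.
  move=> a b; rewrite !mem_iota !add1n !ltnS => aI bI.
  rewrite -!(Fp_natr_eq0 p_prime) !Fp_natr_quadratic !addr_eq0 => /eqP Ea /eqP Eb.
  apply: (sqr_inj_half kp aI bI); apply: (mulfI (Fp_natr_small p_prime p5 c5)).
  by rewrite Ea Eb.
have c1 : count q1 I <= 1 by apply: q_le1.
have c2 : count q2 I <= 1 by apply: q_le1.
have c0 := count_sqr_add1 nc.
have cU (a b : pred nat) : count (predU a b) I <= count a I + count b I.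
  by rewrite -count_predUI leq_addr.
have cE : count (exceptional p) I <= 1 + (count q1 I + count q2 I).
  apply: leq_trans (cU (fun b => p %| b ^ 2 + 1) (predU q1 q2)) _.
  exact: leq_add c0 (cU _ _).
have szE := size_signed_reps p k; rewrite -/I in szE.
have szle := leq_size_signed_reps (prime_gt0 p_prime) us.
have nv := nvals_prime1 p_prime p5 p_mod3.
(* With c <= 3 exceptional elements, 3(2k - c) = 2p + 10 - 3c is at most 2p + 1, so c = 3 and
   equality holds. *)
have [c1E c2E szL] : [/\ count q1 I = 1, count q2 I = 1 &
    3 * size (signed_reps p k) = 2 * p + 1].
  by clear -c1 c2 cE szE szle nv k3; split; lia.
pose L := [seq fcubic (a%:R : 'F_p)%R | a <- signed_reps p k].
have uL : uniq L.
  have -> : L = [seq (v%:R : 'F_p)%R | v <- [seq cubic a %% p | a <- signed_reps p k]].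
    rewrite -map_comp; apply: eq_map => a /=; rewrite -natr_cubic.
    by apply/eqP; rewrite Fp_natr_eq // modn_mod.
  rewrite map_inj_in_uniq // => _ _ /mapP[a _ ->] /mapP[b _ ->] /eqP.
  by rewrite Fp_natr_eq // !modn_mod => /eqP.
have [o oE] := Fp_cube_root p_prime p5 p_mod3.
have n3 := Fp_three_neq0 p_prime p5.
have permL : perm_eq (enum [set fcubic x | x : 'F_p]) L.
  rewrite perm_sym; apply: uniq_perm => //; first exact: enum_uniq.
  have sub : {subset L <= enum [set fcubic x | x : 'F_p]}.
    by move=> v /mapP[a _ ->]; rewrite mem_enum; apply: imset_f.
  apply: (uniq_min_size uL sub _).2.
  rewrite -cardE size_map -(@leq_pmul2l 3) // szL (card_image_fcubic1 n3 oE) card_Fp //.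
have := sum_sqr_image_fcubic n3 oE; rewrite card_Fp // => /(_ p_gt7).
rewrite -big_enum (perm_big _ permL) /= big_map big_cat big_map big_filter -/I.
clear uL permL.
set S := (\sum_(a <- I) fcubic (a%:R : 'F_p) ^+ 2)%R.
(* As f is odd, -b contributes the same square as b; the negatives give S minus its exceptional
   part. *)
have -> : (\sum_(b <- I | ~~ exceptional p b) fcubic ((p - b)%:R : 'F_p) ^+ 2 =
    S - \sum_(b <- I | exceptional p b) fcubic (b%:R : 'F_p) ^+ 2)%R.
  rewrite /S (bigID (exceptional p) predT) /= [(_ + \sum_(b <- I | ~~ _) _)%R]addrC addrK.
  rewrite big_seq_cond [RHS]big_seq_cond; apply: eq_bigr => b /andP[].
  rewrite mem_iota add1n ltnS => /andP[_ bk] _.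
  rewrite natrB ?charp0 ?sub0r; last by move: bk; clear -kp; lia.
  by rewrite /fcubic; ring.
have excE : (27%:R * \sum_(b <- I | exceptional p b) fcubic (b%:R : 'F_p) ^+ 2 = - 8%:R)%R.
  rewrite big_mkcond mulr_sumr (eq_bigr (fun b : nat =>
    (if q1 b then - 4%:R else 0) + (if q2 b then - 4%:R else 0))%R) => [|b _].
    rewrite big_split -!big_mkcond /= !sum_const_count c1E c2E; ring.
  have := sqr_values_exceptional (b%:R : 'F_p)%R.
  rewrite /exceptional -!(Fp_natr_eq0 p_prime) !Fp_natr_quadratic natrD natrX.
  by rewrite /q1 /q2 -!(Fp_natr_eq0 p_prime) !Fp_natr_quadratic.
move: excE; set X := (\sum_(b <- I | _) _)%R => excE sumE.
have {}sumE : (81%:R * (S + (S - X)) = - 2%:R)%R := sumE.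
have S81 : (81%:R * S = - 13%:R)%R.
  apply: (mulfI (Fp_two_neq0 p_prime p5)).
  have -> : (2%:R * (81%:R * S) = 81%:R * (S + (S - X)) + 3%:R * (27%:R * X))%R by ring.
  by rewrite sumE excE; ring.
have k3F : (3%:R * k%:R = 5%:R :> 'F_p)%R by rewrite -natrM k3 natrD charp0 add0r.
have SE := sum_sqr_fcubic 'F_p k.
rewrite (_ : (\sum_(1 <= i < k.+1) _)%R = S) in SE; last first.
  by rewrite /S /I /index_iota subn1.
(* This number is B + 27 x 210 x 13, where B is 3^7 times the closed form of 210 S at 3k = 5. *)
have : ((2 * 3 * 5 * 7 * 13 * 13 * 17 * 31)%:R = 0 :> 'F_p)%R.
  rewrite !natrM.
  pose B : 'F_p := (5%:R * (5%:R + 3%:R) * (2%:R * 5%:R + 3%:R) *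
      (81%:R * 35%:R + 14%:R * (27%:R * 5%:R ^+ 2 + 81%:R * 5%:R - 81%:R)
       + 5%:R * (3%:R * 5%:R ^+ 4 + 18%:R * 5%:R ^+ 3 - 81%:R * 5%:R + 81%:R)))%R.
  have E : (3%:R ^+ 7 * (210%:R * S) = B)%R by rewrite /B SE -k3F; ring.
  have E' : (3%:R ^+ 7 * (210%:R * S) = 27%:R * 210%:R * (81%:R * S))%R by ring.
  transitivity (B - 27%:R * 210%:R * - 13%:R)%R; first by rewrite /B; ring.
  by rewrite -E E' S81 subrr.
move=> /eqP; rewrite Fp_natr_eq0 // !Euclid_dvdM // !dvdn_prime2 //.
move=> H; exfalso; move: H p_gt7 p_mod3 p13 p31; clear.
by do ?[case/orP] => /eqP->.
Qed.

End TightPrime.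

(** * General moduli *)

(** An even e misses at least half of the residues. Otherwise the least prime factor p of e is at
    least 5; two residues are missed modulo p, by computation if p = 7, and hence modulo e. *)
Lemma nvals_small e : 3 < e -> ~~ (3 %| e) -> nvals e + 2 <= e.
Proof.
move=> e3 ne; have e0 : 0 < e by apply: leq_trans e3.
have [e2|o2] := boolP (2 %| e).
  by have := nvals_even e2; clear -e3; lia.
have pp : prime (pdiv e) by rewrite pdiv_prime // (leq_trans _ e3).
have := pdiv_dvd e; move: (pdiv e) pp => p pp pe.
have p5 : 5 <= p.
  have p2 : p != 2 by apply: contraNneq o2 => <-.
  have p3 : p != 3 by apply: contraNneq ne => <-.
  have p4 : p != 4 by apply: contraTneq pp => ->.
  by have := prime_gt1 pp; clear -p2 p3 p4; lia.
have np : nvals p + 2 <= p.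
  have [->//|p7] := eqVneq p 7.
  by apply: nvals_split; rewrite ?prime_gt0 //; apply: split_mod_prime.
have := nvals_dvd e0 pe; have := divnK pe.
have : 0 < e %/ p by rewrite divn_gt0 ?prime_gt0 // dvdn_leq.
move: (e %/ p) (nvals p) np => q v np q0 <-.
have : q * (v + 2) <= q * p by rewrite leq_mul2l np orbT.
by rewrite mulnDr; move: (q * v) (q * p); clear -q0; lia.
Qed.

Lemma split_mod_8 : split_mod 8.
Proof. by exists 2, 1. Qed.

Lemma collides_double P n : 0 < P -> coprime 2 P -> nvals P < n -> collides n (2 * P).
Proof.
move=> P0 cop nP; apply: (@collides_pigeonhole n 2 P (iota 1 n)) => //.
- exact: iota_uniq.
- by move=> a; rewrite mem_iota add1n ltnS.
- by move=> a b _ _; rewrite !modn2 !(negPf (cubic_even _)).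
by rewrite size_iota.
Qed.

Lemma collides_split n P e : 0 < P -> 0 < e -> coprime P e -> split_mod P ->
  ~~ (3 %| P) -> P * e + 4 <= 3 * n -> collides n (P * e) \/ e = 1 \/ e = 2.
Proof.
move=> P0 e0 cop sp P3 le.
have le' : P * e <= 3 * n by apply: leq_trans le; apply: leq_addr.
have [e3|e3] := boolP (3 %| e); first by left; apply: collides_mul3.
have [e4|e4] := ltnP 3 e.
  by left; apply: collides_coprime => //; apply: nvals_small.
by right; case: e e0 e3 e4 {cop le le'} => [|[|[|[|]]]] // _ _ _; [left|right].
Qed.

(** Let P = p^(i+1) be the exact power of p in m. If p = 1 modulo 3 and i > 0, a double root gives a
    collision; otherwise P is split, and [collides_split] leaves only m = P and m = 2P. *)
Lemma collides_prime_power k p m n : 3 ^ k.-1 < n -> m < 3 ^ k -> m + 4 <= 3 * n ->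
  0 < m -> prime p -> 5 <= p -> p != 7 -> p %| m -> collides n m.
Proof.
move=> kn km mn m0 pp p5 p7 pm.
have lp : 0 < logn p m by rewrite logn_gt0 mem_primes pp m0.
have [e cop mE] := pfactor_coprime pp m0.
move: lp mE; case: (logn p m) => // i _; rewrite mulnC => mE.
have p3 : ~~ (3 %| p).
  rewrite dvdn_prime2 //; apply/eqP => p3.
  by move: p5; rewrite -p3.
have e0 : 0 < e by case: e mE {cop} => // mE; move: m0; rewrite mE muln0.
have P0 : 0 < p ^ i.+1 by rewrite expn_gt0 prime_gt0.
have [|r3] : p %% 3 = 1 \/ p %% 3 = 2.
- by move: p3; rewrite /dvdn; have := ltn_pmod p (isT : 0 < 3); clear; lia.
- move=> r3; case: i mE P0 => [|i] mE P0; last first.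
    apply: (collides_sqr_dvd pp p5) => //; last by clear -mn; lia.
    by rewrite mE dvdn_mulr // dvdn_exp2l.
  rewrite expn1 in mE P0.
  have := @collides_split n p e P0 e0; rewrite -mE => /(_ cop (split_mod_prime pp p5 p7) p3 mn).
  case=> [//|[] eE]; rewrite {}eE ?muln1 in mE cop.
    rewrite mE in kn km mn *.
    (* f is injective modulo 13 on [1, 7], so the bound 3n >= 17 is too weak; but 13 > 3^2 forces n
       > 9. *)
    have [p13|p13] := eqVneq p 13.
      have k3 : 2 < k by rewrite -(@ltn_exp2l 3) //; apply: leq_ltn_trans km; rewrite p13.
      apply: (@collidesW 8); last by exists 5, 8; rewrite p13.
      apply: ltnW; apply: leq_ltn_trans kn; apply: leq_trans (_ : 3 ^ 2 <= _) => //.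
      by rewrite leq_exp2l //; clear -k3; lia.
    have [p31|p31] := eqVneq p 31.
      apply: (@collidesW 5); last by exists 4, 5; rewrite p31.
      by rewrite p31 in mn; clear -mn; lia.
    apply: collides_prime1 => //.
    by rewrite ltn_neqAle eq_sym p7 /=; case: (p) p5 r3 => [|[|[|[|[|[|[|]]]]]]].
  rewrite mE mulnC; apply: collides_double => //; first by rewrite coprime_sym.
  have := nvals_prime1 pp p5 r3; rewrite mE in mn; clear -mn; lia.
have := @collides_split n (p ^ i.+1) e P0 e0; rewrite -mE.
rewrite coprimeXl // => /(_ isT (split_mod_lift i pp (split_mod_prime pp p5 p7))).
rewrite Euclid_dvdX // (negPf p3) /= => /(_ isT mn).
case=> [//|[] eE]; rewrite {}eE ?muln1 in mE cop.
  by rewrite mE; apply: collides_prime_power2; rewrite // -mE.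
rewrite mE mulnC; apply: collides_double => //; first by rewrite coprime_sym coprimeXl.
have pP : p %| p ^ i.+1 by rewrite expnS dvdn_mulr.
have := nvals_dvd P0 pP; have := nvals_prime2 pp p5 r3; have := divnK pP.
move: (p ^ i.+1 %/ p) (nvals p) (nvals (p ^ i.+1)) => q v V qE v3 VE.
have : q * (3 * v) <= q * (2 * p - 1) by rewrite leq_mul2l v3 orbT.
rewrite mE in mn; rewrite mulnBr mulnCA [q * (2 * p)]mulnCA qE.
by move: (q * v) VE (p ^ i.+1) mn; clear; lia.
Qed.

(** Write m = M 3^j with M prime to 3. Primes p >= 5 other than 7, and the factors 8 and 49, are
    eliminated, so M divides 28. If M is 1 or even, m is small enough to collide, which leaves M =
    7. *)
Lemma collides_below k n m : 0 < k -> 3 ^ k.-1 < n -> 0 < m -> m < 3 ^ k ->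
  collides n m \/
  exists j, [/\ m = 7 * 3 ^ j, j %% 6 = 4 & 3 ^ j.+1 < n <= 3 ^ j.+1 + 2].
Proof.
move=> k0 kn m0 km.
have k3 : 3 ^ k = 3 * 3 ^ k.-1 by rewrite -expnS prednK.
have m3n : m < 3 * n.
  by rewrite k3 in km; apply: leq_trans km _; rewrite leq_mul2l ltnW.
have [m16|m16] := boolP (16 %| m); first by left; apply: collides_16.
have [p7|m49] := boolP (49 %| m).
  by left; apply: (@collides_sqr_dvd 7).
have [M cop mE] := pfactor_coprime (isT : prime 3) m0.
set j := logn 3 m in mE.
have t0 : 0 < 3 ^ j by rewrite expn_gt0.
(* 3^(t+j) <= m < 3^k, so t + j <= k - 1. *)
have jk t : 3 ^ t <= M -> 3 ^ (t + j) < n.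
  move=> tM; apply: leq_ltn_trans kn; rewrite leq_exp2l // -ltnS prednK //.
  rewrite -(@ltn_exp2l 3) // expnD; apply: leq_ltn_trans km.
  by rewrite mE leq_mul2r tM orbT.
have M0 : 0 < M by case: (M) mE => // mE; move: m0; rewrite mE.
have [M1|M1] := eqVneq M 1.
  left; apply: collides_lt => //; rewrite mE M1 mul1n.
  by have := jk 0; rewrite M1 add0n; apply.
(* m + 1 <= 3^k and 3^(k-1) + 1 <= n; the 4 is 1 + 3. *)
have mn : m + 4 <= 3 * n.
  have k3' : m.+1 <= 3 * 3 ^ k.-1 by rewrite -k3.
  by move: k3' kn; clear; lia.
have pM0 p : p %| M -> p %| m by move=> pM; rewrite mE dvdn_mulr.
have [/hasP[p]|/hasPn H] := boolP (has (fun p => (4 < p) && (p != 7)) (primes M)).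
  rewrite mem_primes => /and3P[pp _ /pM0 pm] /andP[p5 p7].
  by left; apply: collides_prime_power kn km _ _ pp p5 p7 pm.
have [m8|m8] := boolP (8 %| m).
  have [e cop2 m8E] : exists2 e, coprime 8 e & m = 8 * e.
    move: m8 => /dvdnP[e eE]; exists e; last by rewrite mulnC.
    rewrite (_ : 8 = 2 ^ 3) // coprimeXl // coprime2n; apply: contraNT m16 => o.
    rewrite eE (_ : 16 = 2 * 8) // dvdn_mul // dvdn2 o //.
  have e0 : 0 < e by case: (e) m8E => // E; move: m0; rewrite E.
  have := @collides_split n 8 e isT e0 cop2 split_mod_8 isT; rewrite -m8E => /(_ mn).
  case=> [|[eE|eE]]; first by left.
    left; rewrite m8E eE; apply: (@collidesW 4); first by rewrite m8E eE in mn; clear -mn; lia.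
    by exists 1, 2.
  by rewrite eE in cop2.
have M28 : M %| 28.
  apply/dvdn_partP => // p pM; rewrite p_part.
  have pp : prime p by move: pM; rewrite mem_primes => /andP[].
  have p3 : p != 3.
    apply: contraTneq pM => ->; rewrite mem_primes /= M0 /=.
    by rewrite -prime_coprime ?cop.
  have p4 : p != 4 by apply: contraTneq pp => ->.
  have p27 : p = 2 \/ p = 7.
    have := H p pM; have := prime_gt1 pp; clear -p3 p4; lia.
  have lg c : ~~ (p ^ c.+1 %| M) -> p ^ logn p M %| p ^ c.
    by rewrite pfactor_dvdn // -leqNgt => lc; rewrite dvdn_exp2l.
  case: p27 lg => -> lg.
    by apply: (dvdn_trans (lg 2 _)) => //; apply: contraNN m8 => /pM0.
  by apply: (dvdn_trans (lg 1 _)) => //; apply: contraNN m49 => /pM0.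
have : M \in divisors 28 by rewrite -dvdn_divisors.
rewrite (_ : divisors 28 = [:: 1; 2; 4; 7; 14; 28]) // !inE (negPf M1) /=.
(* A power 3^t between M/2 and M gives m <= 2 3^(t+j) < 2n. *)
have even t c : M = 2 * c -> 3 ^ t <= M -> c <= 3 ^ t -> collides n m.
  move=> Mc tM ct; apply: collides_even => //; first by rewrite mE Mc -mulnA dvdn_mulr.
  have := jk t tM; rewrite expnD mE Mc -mul2n -mulnA ltn_pmul2l //.
  by apply: leq_ltn_trans; rewrite leq_mul2r ct orbT.
case/or4P=> [||| /orP[]] /eqP ME.
- by left; apply: (even 0 1); rewrite ?ME.
- by left; apply: (even 1 2); rewrite ?ME.
- have j1n : 3 ^ j.+1 < n by apply: (jk 1); rewrite ME.
  rewrite mE ME; have [c|[j4 le]] := collides_7_pow3 j1n; first by left.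
  by right; exists j; rewrite j1n.
- by left; apply: (even 2 7); rewrite ?ME.
by left; apply: (even 3 14); rewrite ?ME.
Qed.

(** * Determination of Delta *)

Lemma Delta_eq n D : 0 < D -> ~ collides n D ->
  (forall m, 0 < m -> m < D -> collides n m) -> Delta n = D.
Proof.
move=> D0 nD H; rewrite /Delta; case: ex_minnP => m /andP[m0 dm] min_m.
apply/eqP; rewrite eqn_leq min_m; last first.
  by rewrite D0; apply/negPn/negP => /distinct_modPn.
rewrite leqNgt; apply/negP => mD.
by have /distinct_modPn := H m m0 mD; rewrite dm.
Qed.

Theorem theorem1p1 (n : nat) (n_gt0 : 0 < n) :
  (forall s : nat,
     n = 3 ^ (6 * s + 5) + 1 \/ n = 3 ^ (6 * s + 5) + 2 ->
     Delta n = 7 * 3 ^ (6 * s + 4))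
  /\
  (~ (exists s : nat, n = 3 ^ (6 * s + 5) + 1 \/ n = 3 ^ (6 * s + 5) + 2) ->
     Delta n = 3 ^ up_log 3 n).
Proof.
split=> [s nE|nE].
  have j4 : (6 * s + 4) %% 6 = 4 by rewrite mulnC modnMDl.
  have jS : (6 * s + 5) = (6 * s + 4).+1 by rewrite -addnS.
  have t0 : 0 < 3 ^ (6 * s + 4) by rewrite expn_gt0.
  rewrite jS in nE; move: (6 * s + 4) nE j4 t0 => j nE j4 t0.
  have nj : 3 ^ j.+1 < n by case: nE => ->; lia.
  apply: Delta_eq; first by rewrite muln_gt0.
    by apply: not_collides_7_pow3 => //; case: nE => ->; lia.
  move=> m m0 mD.
  have mj : m < 3 ^ j.+2 by apply: ltn_trans mD _; rewrite !expnS; clear -t0; lia.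
  have [//|[i [mE _ _]]] := @collides_below j.+2 n m isT nj m0 mj.
  (* A smaller exceptional modulus is at most 7 3^(j-1) < 3^(j+1) < n, so it collides trivially. *)
  apply: collides_lt => //; apply: leq_ltn_trans nj.
  move: mD; rewrite mE ltn_pmul2l // ltn_exp2l // => ij.
  apply: leq_trans (_ : 7 * 3 ^ j.-1 <= _); first by rewrite leq_pmul2l // leq_exp2l //; lia.
  by case: (j) ij => // j' _; rewrite !expnS succnK; lia.
have [n1|n1] := leqP n 1.
  have -> : n = 1 by lia.
  rewrite up_log1; apply: Delta_eq => //; last by case.
  by move=> [a [b [a0 ab b1 _]]]; move: a0 ab b1; clear; lia.
have /andP[kn nk] := up_log_bounds (isT : 1 < 3) n1.
apply: Delta_eq; rewrite ?expn_gt0 //; first exact: collides_pow3.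
move=> m m0 mk.
have k0 : 0 < up_log 3 n by rewrite up_log_gt0.
have [//|[j [_ j4 /andP[jn nj]]]] := collides_below k0 kn m0 mk.
case: nE; exists (j %/ 6).
have -> : 6 * (j %/ 6) + 5 = j.+1 by rewrite [in RHS](divn_eq j 6) j4 mulnC addnS.
by move: jn nj; clear; lia.
Qed.
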